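(* Let $r\geq 3$ and $s\geq 1$ be integers, let $F(x,y)\in\mathbb Z[x,y]$ be an irreducible binary form of degree $r$ having at most $s+1$ non-zero coefficients, and let $h\geq 1$ be an integer. Then $$N(F,h)\leq 2\left(1+\log^*h^{1/r}\right)\left(3+4h^{1/r}+\frac{e^{105}h^{2/r}}{|D(F)|^{1/(r(r-1))}}\right)\left(1+8r+48s\left(15+\frac{1}{\log(r-1)}\log\log^*(2h^{1/r})\right)\right).$$
   Context: Write $F(x,y)=a_0x^r+a_1x^{r-1}y+\cdots+a_ry^r$ and let $\alpha_1,\dots,\alpha_r$ be the roots of $F(x,1)$, so $F(x,y)=a_0\prod_{i=1}^r(x-\alpha_iy)$. The discriminant is $D(F)=a_0^{2r-2}\prod_{1\le i<j\le r}(\alpha_i-\alpha_j)^2$. For an integer $h\ge1$, $N(F,h)$ denotes the number of pairs $(x,y)\in\mathbb Z^2$, $(x,y)\neq(0,0)$, with $|F(x,y)|\leq h$. For real $x$, $\log^*x=1$ if $x\le e$ and $\log^*x=\log x$ if $x>e$. *)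

(* Defs.v *)
From HB Require Import structures.
From mathcomp Require Import all_boot all_order all_algebra.
(* mpoly must be imported before mathcomp-analysis: in the other order the
   notations clash. *)
From mathcomp Require Import finmap complex mpoly.
From mathcomp Require Import classical_sets cardinality reals sequences exp.

Set Implicit Arguments.
Unset Strict Implicit.
Unset Printing Implicit Defensive.

Import Order.TTheory GRing.Theory Num.Theory.

Local Open Scope classical_set_scope.
Local Open Scope ring_scope.

Definition irreducible_elt (D : unitRingType) (p : D) : Prop :=
  [/\ p != 0, p \isn't a GRing.unit &
      forall a b : D, p = a * b -> a \is a GRing.unit \/ b \is a GRing.unit].

(* F need not be primitive: the irreducibility is that in Q[x, y], not in
   Z[x, y] (where it would also force the coefficients to be coprime). *)
Definition irreducible_form (F : {mpoly int[2]}) : Prop :=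
  irreducible_elt (map_mpoly intr F : {mpoly rat[2]}).

Definition pair_val (T : Type) (x y : T) : 'I_2 -> T :=
  fun i => if i == ord0 then x else y.

Definition thue_solutions (F : {mpoly int[2]}) (h : nat) : set (int * int) :=
  [set p | p != (0, 0) /\ `|F.@[pair_val p.1 p.2]| <= h%:Z].

(* The univariate polynomial F(x, 1). *)
Definition dehomog (F : {mpoly int[2]}) : {poly int} :=
  mmap polyC (pair_val 'X 1) F.

(* The complex roots of F(x, 1), with multiplicity, in an unspecified order. *)
Definition form_roots (R : realType) (F : {mpoly int[2]}) : seq R[i] :=
  sval (closed_field_poly_normal (map_poly intr (dehomog F))).

(* The discriminant of a form F of degree r with nonzero coefficient a_0 of
   x^r (so that F(x, 1) has exactly r roots). *)
Definition form_disc (R : realType) (r : nat) (F : {mpoly int[2]}) : R[i] :=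
  let a0 : int := mcoeff (U_(ord0) *+ r)%MM F in
  let alpha := form_roots R F in
  a0%:~R ^+ (2 * r - 2) *
  \prod_(i < r) \prod_(j < r | (i < j)%N) (alpha`_i - alpha`_j) ^+ 2.

Definition logstar (R : realType) (x : R) : R :=
  if x <= expR 1 then 1 else ln x.

(* Main.v *)
(** A Bombieri-Schmidt argument, giving O(r) primitive solutions once the
    discriminant is large. Write F as a product of r complex linear forms L_i,
    with height M = prod max(|a_i|, |b_i|), and let Delta = |D(F)|^(1/(r(r-1))),
    which is multiplied by n when F is restricted to a sublattice of index n.

    Dividing by the gcd reduces to primitive solutions. Covering the primitive
    points by 2^(k+1) lattices of index 2^k, one may assume that Delta is at
    least a large constant times h^(2/r); then every equivalent form has height
    at least B^r h. Take a form of almost minimal height M in its class.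

    Small solutions (y <= M^4): completing a solution (x, y) to a basis of Z^2
    and comparing heights gives prod_i (1 + t_i) >= M / (2h), where t_i is the
    inverse of y^2 |alpha_i - x/y|. When t_i is large, the next solution close
    to alpha_i has its y larger by a factor at least t_i / 2. Multiplying these
    gaps over all roots leaves O(r) small solutions.

    Large solutions: each is very close to its nearest root, with |alpha - x/y|
    <= M^(r-1) / y^r, so log y grows geometrically with ratio r - 1 along the
    solutions close to a given root. Thue's method (polynomials A, B in Z[X]
    with A - alpha B vanishing to order k at alpha, a Wronskian nonvanishing
    argument) forbids two such solutions with log y_2 >= 33 r log y_1, hence at
    most 22 large solutions per root. *)
Require Import Defs.
From HB Require Import structures.
From mathcomp Require Import all_boot all_order all_algebra.
From mathcomp Require Import finmap complex mpoly.
From mathcomp Require Import classical_sets cardinality reals sequences exp.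
From mathcomp Require Import zify ring lra.

Set Implicit Arguments.
Unset Strict Implicit.
Unset Printing Implicit Defensive.

Import Order.TTheory GRing.Theory Num.Theory.

Local Open Scope classical_set_scope.
Local Open Scope ring_scope.

(** Write l = log* h^(1/r). The term in h^(2/r) / Delta is the price of enlarging the discriminant:
    the index 2^k is about a constant times h^(2/r) / Delta, and each of the 2^(k+1) lattices holds
    O(r (1 + l)) primitive points. For points of gcd g, h becomes h / g^r, so h^(2/r) is divided by
    g^2 and the sum over g converges; the part of the bound free of Delta is summed over g <=
    h^(1/r) and gives the term in h^(1/r). The factor 1 + l comes from the small solutions alone.
    With X of the order of M / h, the product of the gaps bounds their number n, up to r exceptions,
    by X^n <= M^(4r). Now ln M exceeds ln X by at most O(r) + ln h, with ln h <= r l, while ln X >=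
    20 r; hence ln M / ln X = O(1 + l). In Thue's method the vanishing order k must be close to its
    extreme value 2N/r, since otherwise the first approximation is not exploited enough when r = 3.
    This leaves Siegel's lemma little freedom, so its exponent is as large as 20 r, and the method
    starts only at ln y >= 1000 r^2 ln M. Some of the 22 large solutions per root are spent on
    reaching this threshold, the others on reaching the ratio 33 r. *)

Local Notation nc := ComplexField.Normc.normc.

(** * Complex absolute value and Siegel's lemma *)

Section ComplexNorm.
Variable R : realType.
Implicit Types z w : R[i].

Lemma nc_ge0 z : 0 <= nc z.
Proof. by case: z => a b; rewrite /= sqrtr_ge0. Qed.

Lemma ncM z w : nc (z * w) = nc z * nc w.
Proof. exact: ComplexField.Normc.normcM. Qed.

Lemma nc0 : nc (0 : R[i]) = 0.
Proof. exact: ComplexField.Normc.normc0. Qed.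

Lemma nc1 : nc (1 : R[i]) = 1.
Proof. exact: ComplexField.Normc.normc1. Qed.

Lemma ncV z : nc z^-1 = (nc z)^-1.
Proof. exact: ComplexField.Normc.normcV. Qed.

Lemma ncN z : nc (- z) = nc z.
Proof. exact: normcN. Qed.

Lemma ncD z w : nc (z + w) <= nc z + nc w.
Proof. exact: le_normcD. Qed.

Lemma ncB z w : nc (z - w) <= nc z + nc w.
Proof. by rewrite -(ncN w) ncD. Qed.

Lemma nc_eq0 z : (nc z == 0) = (z == 0).
Proof.
apply/eqP/eqP => [/ComplexField.Normc.eq0_normc //|->]; exact: nc0.
Qed.

Lemma nc_gt0 z : (0 < nc z) = (z != 0).
Proof. by rewrite lt0r nc_ge0 andbT nc_eq0. Qed.

Lemma ncX z n : nc (z ^+ n) = nc z ^+ n.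
Proof. by elim: n => [|n IH]; rewrite ?expr0 ?nc1 // !exprS ncM IH. Qed.

Lemma nc_prod I (s : seq I) (P : pred I) (F : I -> R[i]) :
  nc (\prod_(i <- s | P i) F i) = \prod_(i <- s | P i) nc (F i).
Proof.
by elim/big_rec2: _ => [|i y x _ H]; rewrite ?nc1 // ncM H.
Qed.

Lemma nc_sum I (s : seq I) (P : pred I) (F : I -> R[i]) :
  nc (\sum_(i <- s | P i) F i) <= \sum_(i <- s | P i) nc (F i).
Proof.
elim/big_rec2: _ => [|i y x _ H]; first by rewrite nc0.
by apply: le_trans (ncD _ _) _; rewrite lerD2l.
Qed.

Lemma nc_real (x : R) : nc (x%:C)%C = `|x|.
Proof. by rewrite /= expr0n /= addr0 sqrtr_sqr. Qed.

Lemma nc_int (n : int) : nc (n%:~R : R[i]) = `|n|%:~R.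
Proof.
have -> : (n%:~R : R[i]) = ((n%:~R : R)%:C)%C by rewrite rmorph_int.
by rewrite nc_real intr_norm.
Qed.

Lemma nc_nat (n : nat) : nc (n%:R : R[i]) = n%:R.
Proof. by rewrite -[n%:R]/((Posz n)%:~R) nc_int. Qed.

Lemma nc_int_ge1 (n : int) : n != 0 -> 1 <= nc (n%:~R : R[i]).
Proof. by move=> n0; rewrite nc_int -[1]/(1%:~R) ler_int; lia. Qed.

End ComplexNorm.

Lemma siegel (I J : finType) (a : J -> I -> int) (E w : nat) :
    (0 < E)%N -> (#|J| < #|I|)%N -> (#|J| <= w * (#|I| - #|J|))%N ->
    (forall j i, `|a j i| <= E%:Z) ->
  exists v : I -> int, [/\ exists i, v i != 0,
    forall i, `|v i| <= ((2 * #|I| * E) ^ w)%N%:Z &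
    forall j, \sum_i a j i * v i = 0].
Proof.
(* Pigeonhole on the vectors with entries in [0, X]. *)
move=> E0 hJI hw hE; set n := #|I|; set m := #|J|; set X := ((2 * n * E) ^ w)%N.
pose Y := (n * E * X)%N.
pose S (v : {ffun I -> 'I_X.+1}) (j : J) : int := \sum_i a j i * (v i : nat)%:Z.
have SB v j : `|S v j| <= Y%:Z.
  apply: le_trans (ler_norm_sum _ _ _) _.
  have -> : Y%:Z = \sum_(i : I) (E * X)%:Z.
    by rewrite sumr_const -/n /Y -mulnA; lia.
  apply: ler_sum => i _; rewrite normrM PoszM ler_pM //.
  by rewrite ger0_norm // lez_nat -ltnS ltn_ord.
pose G (v : {ffun I -> 'I_X.+1}) : {ffun J -> 'I_(2 * Y).+1} :=
  [ffun j => inord (absz (S v j + Y%:Z))].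
have : ~~ injectiveb G.
  apply/negP => /injectiveP /leq_card; rewrite !card_ffun !card_ord -/n -/m.
  apply/negP; rewrite -ltnNge.
  have n0 : (0 < n)%N by lia.
  have h1 : ((2 * Y).+1 <= (2 * n * E) * X.+1)%N.
    rewrite /Y; have : (0 < n * E)%N by rewrite muln_gt0 n0.
    by move: (n * E)%N (mulnA 2 n E) => t <-; nia.
  apply: (@leq_ltn_trans (((2 * n * E) * X.+1) ^ m));
    first by case: (posnP m) => [->|mm] //; rewrite leq_exp2r.
  rewrite expnMn -[X in (_ < _ ^ X)%N](subnK (ltnW hJI)) -/n -/m expnD.
  rewrite ltn_pmul2r ?expn_gt0 //.
  (* Since m <= w (n - m), the factor (2nE)^m is at most (2nE)^(w (n - m)) = X^(n - m): this
     dictates the choice of X. *)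
  apply: (@leq_ltn_trans (X ^ (n - m))).
    rewrite /X -expnM leq_pexp2l ?muln_gt0 ?n0 ?E0 //.
  by rewrite ltn_exp2r // subn_gt0.
move=> /injectivePn [u [v /eqP uv Guv]].
have Suv j : S u j = S v j.
  have /(congr1 val) : G u j = G v j by rewrite Guv.
  rewrite !ffunE /=.
  have := SB u j; have := SB v j; move: (S u j) (S v j) => p q Hq Hp.
  by rewrite !inordK; lia.
exists (fun i => (u i : nat)%:Z - (v i : nat)%:Z); split.
- have : [exists i, u i != v i].
    rewrite -negb_forall; apply/negP => /forallP H; apply: uv.
    by apply/ffunP => i; apply/eqP.
  case/existsP => i Hi; exists i; rewrite subr_eq0.
  by apply: contraNneq Hi => -[] /val_inj ->.
- by move=> i; have := ltn_ord (u i); have := ltn_ord (v i); lia.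
- move=> j; under eq_bigr do rewrite mulrBr.
  by rewrite sumrB; apply/eqP; rewrite subr_eq0; apply/eqP/Suv.
Qed.

(** * Auxiliary polynomials *)

Fixpoint redc (f : {poly int}) (r n l : nat) : int :=
  if n is n'.+1 then
    (if l is l'.+1 then f`_r * redc f r n' l' else 0) - redc f r n' r.-1 * f`_l
  else (l == 0)%:R.

(* [redc f r n] lists the coordinates of (a_r alpha)^n on 1, ..., alpha^(r-1),
   for alpha a root of f of degree r and leading coefficient a_r. *)
Lemma redcE (C : comNzRingType) (f : {poly int}) (r n : nat) (x : C) :
    (0 < r)%N -> size f = r.+1 -> (map_poly intr f).[x] = 0 ->
  (f`_r)%:~R ^+ n * x ^+ n = \sum_(l < r) (redc f r n l)%:~R * x ^+ l.
Proof.
case: r => // r _ sf fx; elim: n => [|n IH].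
  by rewrite !expr0 mulr1 big_ord_recl /= big1 ?addr0 ?mulr1 // => i _; rewrite mul0r.
have {fx} : \sum_(l < r.+2) (f`_l)%:~R * x ^+ l = 0.
  rewrite -[RHS]fx (@horner_coef_wide _ r.+2); last first.
    by rewrite -sf size_poly.
  by apply: eq_bigr => i _; rewrite coef_map.
rewrite big_ord_recr /= => /eqP; rewrite addrC addr_eq0 => /eqP fx.
rewrite !exprS mulrACA IH big_ord_recr /= mulrDr.
rewrite [RHS](eq_bigr (fun l : 'I_r.+1 =>
    ((if (l : nat) is l'.+1 then f`_r.+1 * redc f r.+1 n l' else 0)%:~R * x ^+ l
    - (redc f r.+1 n r)%:~R * ((f`_l)%:~R * x ^+ l)))); last first.
  by move=> i _; rewrite rmorphB rmorphM /= mulrBl mulrA.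
rewrite sumrB; congr (_ + _).
  rewrite [RHS]big_ord_recl mulr0z mul0r add0r mulr_sumr; apply: eq_bigr => i _.
  by rewrite lift0 /= rmorphM /= exprS; ring.
rewrite -mulr_sumr -mulrN -fx exprS; ring.
Qed.

Lemma redc_le (f : {poly int}) (r H n l : nat) :
    (0 < H)%N -> (forall i, `|f`_i| <= H%:Z) ->
  `|redc f r n l| <= ((2 * H) ^ n)%N%:Z.
Proof.
move=> H0 fH; elim: n l => [|n IH] l /=; first by case: (l == 0%N).
apply: le_trans (ler_normB _ _) _.
have h1 : `|redc f r n r.-1 * f`_l| <= ((2 * H) ^ n * H)%N%:Z.
  by rewrite normrM PoszM ler_pM.
have h2 : `|if l is l'.+1 then f`_r * redc f r n l' else 0|
    <= ((2 * H) ^ n * H)%N%:Z.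
  by case: l {h1} => [|l]; rewrite ?normr0 // mulnC normrM PoszM ler_pM.
by apply: le_trans (lerD h2 h1) _; rewrite expnS; lia.
Qed.

Lemma bin_le_exp2 (n j : nat) : ('C(n, j) <= 2 ^ n)%N.
Proof.
elim: n j => [|n IH] [|j]; rewrite ?bin0 ?expn_gt0 ?bin0n // binS expnS.
by have := IH j; have := IH j.+1; lia.
Qed.

Section AuxPoly.
Variables (C : numFieldType) (f : {poly int}) (r H : nat) (x : C).
Hypotheses (r0 : (0 < r)%N) (sf : size f = r.+1) (fx : (map_poly intr f).[x] = 0).
Hypotheses (H0 : (0 < H)%N) (fH : forall i, `|f`_i| <= H%:Z).
Variables (N k w : nat).
Hypotheses (kN : (k * r < 2 * N)%N) (kw : (k * r <= w * (2 * N - k * r))%N).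

(** For jl = (j, l), the coordinate on x^l of a_r^N C(n, j) x^t. The common factor a_r^N clears all
    denominators at once, so that the linear system is integral. *)
Let coefA (jl : 'I_k * 'I_r) (n : nat) (t : nat) : int :=
  'C(n, jl.1)%:Z * (f`_r ^+ (N - t) * redc f r t jl.2).

Let coefA_le jl n t : (n <= N)%N -> (t <= N)%N ->
  `|coefA jl n t| <= ((4 * H) ^ N)%N%:Z.
Proof.
move=> nN tN; rewrite /coefA !normrM.
have -> : ((4 * H) ^ N = 2 ^ N * (((2 * H) ^ (N - t)) * (2 * H) ^ t))%N.
  by rewrite -expnD subnK // -expnMn; congr (_ ^ _)%N; lia.
rewrite !PoszM; apply: ler_pM => //.
  by rewrite lez_nat (leq_trans (bin_le_exp2 _ _)) // leq_pexp2l.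
apply: ler_pM => //; last exact: redc_le.
rewrite normrX; apply: le_trans (_ : (H%:Z) ^+ (N - t) <= _).
  by apply: lerXn2r => //; rewrite nnegrE.
have -> : (H%:Z) ^+ (N - t) = (H ^ (N - t))%N%:Z.
  by elim: (N - t)%N => // e IHe; rewrite exprS IHe expnS PoszM.
rewrite lez_nat; case: (posnP (N - t)) => [->//|e0].
by rewrite leq_exp2r //; lia.
Qed.

(** Each of the k vanishing conditions follows from r integral equations, one for each power x^l, in
    the 2N unknown coefficients of A and B. Siegel's lemma applies with E = (4H)^N. *)
Lemma aux_poly : exists A B : {poly int},
  [/\ (A != 0) || (B != 0), (size A <= N)%N && (size B <= N)%N,
    forall i, `|A`_i| <= ((4 * N * (4 * H) ^ N) ^ w)%N%:Z
      /\ `|B`_i| <= ((4 * N * (4 * H) ^ N) ^ w)%N%:Z &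
    forall j, (j < k)%N -> (map_poly intr A)^`N(j).[x]
      = x * (map_poly intr B)^`N(j).[x] :> C].
Proof.
(* The successor in the second case is the factor x of x B. When n < j the truncated exponent n - j
   is harmless, because C(n, j) = 0. *)
pose a (jl : 'I_k * 'I_r) (n : 'I_N + 'I_N) : int :=
  match n with
  | inl n => coefA jl n (n - jl.1)
  | inr n => - coefA jl n (n - jl.1).+1
  end.
have a_le jl n : `|a jl n| <= ((4 * H) ^ N)%N%:Z.
  case: n => n; rewrite /a ?normrN; apply: coefA_le; have := ltn_ord n; lia.
have cI : #|{: 'I_N + 'I_N}| = (2 * N)%N by rewrite card_sum !card_ord; lia.
have cJ : #|{: 'I_k * 'I_r}| = (k * r)%N by rewrite card_prod !card_ord.
have [|||v [[i0 vi0] v_le v_eq]] := @siegel _ _ a ((4 * H) ^ N)%N w _ _ _ a_le.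
- by rewrite expn_gt0; lia.
- by rewrite cI cJ.
- by rewrite cI cJ.
rewrite cI mulnA in v_le.
have -> : (4 * N = 2 * 2 * N)%N by lia.
pose A := \poly_(n < N) (if insub n is Some n then v (inl n) else 0).
pose B := \poly_(n < N) (if insub n is Some n then v (inr n) else 0).
have AE (n : 'I_N) : A`_n = v (inl n) by rewrite coef_poly ltn_ord valK.
have BE (n : 'I_N) : B`_n = v (inr n) by rewrite coef_poly ltn_ord valK.
exists A, B; split.
- case: i0 vi0 => n; rewrite -?AE -?BE => h; apply/orP; [left|right];
    by apply: contraNneq h => ->; rewrite coef0.
- by rewrite !size_poly.
- by move=> i; split; rewrite coef_poly; case: ltnP => // iN;
    rewrite insubT; apply: v_le.
- move=> j jk.
  have ev (P : {poly int}) (j' : nat) : (size P <= N)%N ->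
      (map_poly intr P)^`N(j').[x] =
      \sum_(n < N) ((P`_n)%:~R * 'C(n, j')%:R * x ^+ (n - j') : C).
    move=> sP; have sP' : (size (map_poly intr P : {poly C}) <= N)%N.
      by apply: leq_trans (size_poly _ _) sP.
    rewrite -[X in nderivn _ X](coefK (map_poly intr P)) poly_def.
    rewrite (big_ord_widen N (fun i => (map_poly intr P)`_i *: 'X^i)) //.
    rewrite big_mkcond /= linear_sum horner_sum; apply: eq_bigr => n _.
    rewrite coef_map /=; case: ltnP => h.
      by rewrite nderivnZ nderivnXn hornerZ hornerMn hornerXn -mulr_natr; ring.
    by rewrite linear0 horner0 -coef_map nth_default // !mul0r.
  have key (P : {poly int}) (s : nat) : (s <= 1)%N -> (size P <= N)%N ->
     (f`_r)%:~R ^+ N * (x ^+ s * (map_poly intr P)^`N(j).[x]) =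
     \sum_(l < r) (\sum_(n < N) P`_n * coefA (Ordinal jk, l) n (n - j + s))%:~R
       * x ^+ l :> C.
    move=> s1 sP; rewrite ev // !mulr_sumr.
    transitivity (\sum_(n < N) \sum_(l < r)
       ((P`_n * coefA (Ordinal jk, l) n (n - j + s))%:~R * x ^+ l : C)).
      apply: eq_bigr => n _; have nN := ltn_ord n.
      transitivity ((P`_n)%:~R * 'C(n, j)%:R * (f`_r)%:~R ^+ (N - (n - j + s)) *
         ((f`_r)%:~R ^+ (n - j + s) * x ^+ (n - j + s)) : C).
        have {1}-> : N = (N - (n - j + s) + (n - j + s))%N by rewrite subnK //; lia.
        by rewrite !exprD; ring.
      rewrite (redcE (n - j + s) r0 sf fx) mulr_sumr; apply: eq_bigr => l _.
      by rewrite /coefA !rmorphM rmorphXn /= -!pmulrn; ring.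
    rewrite exchange_big /=; apply: eq_bigr => l _.
    by rewrite rmorph_sum /= mulr_suml.
  have lead0 : ((f`_r)%:~R : C) ^+ N != 0.
    rewrite expf_neq0 // intr_eq0; have := sf; rewrite -[r]/(r.+1.-1) => <-.
    by rewrite -/(lead_coef f) lead_coef_eq0 -size_poly_eq0 sf.
  have sA : (size A <= N)%N by rewrite size_poly.
  have sB : (size B <= N)%N by rewrite size_poly.
  apply: (mulfI lead0); apply/eqP; rewrite -subr_eq0.
  have := key A 0%N isT sA; rewrite expr0 mul1r => ->.
  have := key B 1%N isT sB; rewrite expr1 => ->.
  rewrite -sumrB big1 // => l _; rewrite -mulrBl -rmorphB /=.
  have := v_eq (Ordinal jk, l); rewrite big_sumType /= => h.
  rewrite (_ : _ - _ = 0) ?mul0r // -[RHS]h -sumrN; congr (_ + _);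
    apply: eq_bigr => n _; rewrite ?AE ?BE ?addn0 ?addn1 /=; ring.
Qed.

End AuxPoly.

(** * Nonvanishing *)

(* x has degree at least r over Q. *)
Definition algdeg (C : numFieldType) (r : nat) (x : C) : Prop :=
  forall G : {poly rat}, (size G <= r)%N -> (map_poly ratr G).[x] = 0 -> G = 0.

Lemma dvdp_nderivn (K : fieldType) (P : {poly K}) (x : K) (k : nat) :
  (forall j, (j < k)%N -> P^`N(j).[x] = 0) -> ('X - x%:P) ^+ k %| P.
Proof.
move=> h.
have -> : P = \sum_(i < size P) (P^`N(i).[x])%:P * ('X - x%:P) ^+ i.
  have hx := @nderiv_taylor _ (map_poly polyC P) x%:P ('X - x%:P) (mulrC _ _).
  rewrite addrC subrK size_map_polyC in hx; rewrite -{1}[P]comp_polyXr /comp_poly hx.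
  by apply: eq_bigr => i _; rewrite nderivn_map horner_map.
apply: (big_ind (fun q => ('X - x%:P) ^+ k %| q)) => [|p q|i _];
  [exact: dvdp0|exact: dvdp_add|].
have [ik|ik] := ltnP i k; first by rewrite h // mul0r dvdp0.
by rewrite dvdp_mull // dvdp_exp2l.
Qed.

Lemma coefM_top (K : nzSemiRingType) (p q : {poly K}) (m n : nat) :
  (size p <= m.+1)%N -> (size q <= n.+1)%N -> (p * q)`_(m + n) = p`_m * q`_n.
Proof.
move=> sp sq; have mn : (m < (m + n).+1)%N by lia.
rewrite coefM (bigD1 (Ordinal mn)) //= addKn big1 ?addr0 // => i im.
have [lt|gt|eq] := ltngtP i m.
- by rewrite [q`__]nth_default ?mulr0 //; apply: (leq_trans sq); lia.
- by rewrite [p`__]nth_default ?mul0r //; apply: (leq_trans sp); lia.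
- by case/eqP: im; apply: val_inj.
Qed.

(** In characteristic 0 the top coefficients of p q' and p' q are deg q and deg p times the same
    nonzero product. The proof compares coefficients after multiplication by X, which avoids a
    predecessor in the degree. *)
Lemma wronskian0_size (p q : {poly rat}) :
  p != 0 -> q != 0 -> p * q^`() = p^`() * q -> size p = size q.
Proof.
move=> p0 q0 eqpq.
have [m sp] : exists m, size p = m.+1 by exists (size p).-1; rewrite polySpred.
have [n sq] : exists n, size q = n.+1 by exists (size q).-1; rewrite polySpred.
have top (u v : {poly rat}) i j : size u = i.+1 -> size v = j.+1 ->
    ('X * (u * v^`()))`_(i + j) = u`_i * (v`_j *+ j).
  move=> su sv; have -> : 'X * (u * v^`()) = u * (v^`() * 'X) by ring.
  have v0 : v != 0 by rewrite -size_poly_eq0 sv.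
  rewrite coefM_top ?su //; last first.
    have [->|dv0] := eqVneq v^`() 0; first by rewrite mul0r size_poly0.
    by rewrite size_mulX // -sv lt_size_deriv.
  by rewrite coefMX; case: j {sv} => [|j] //=; rewrite ?mulr0n ?coef_deriv.
have := top _ _ _ _ sp sq; rewrite eqpq [p^`() * q]mulrC addnC (top _ _ _ _ sq sp).
have lp : p`_m != 0 by rewrite -[m]/(m.+1.-1) -sp -/(lead_coef p) lead_coef_eq0.
have lq : q`_n != 0 by rewrite -[n]/(n.+1.-1) -sq -/(lead_coef q) lead_coef_eq0.
rewrite !mulrnAr [q`_n * _]mulrC -[_ *+ n]mulr_natr -[_ *+ m]mulr_natr => /(mulfI
  (mulf_neq0 lp lq))/eqP.
by rewrite eqr_nat sp sq => /eqP ->.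
Qed.

Lemma dvdp_XsubC_deriv (K : fieldType) (P : {poly K}) (x : K) (k : nat) :
  ('X - x%:P) ^+ k.+1 %| P -> ('X - x%:P) ^+ k %| P^`().
Proof.
case/dvdpP => q ->; rewrite derivM deriv_exp /= derivB derivX derivC subr0 mul1r.
rewrite dvdp_add // ?dvdp_mull ?dvdp_exp2l //.
by rewrite -mulr_natr dvdp_mulr.
Qed.

(** The degree count that closes [zero_estimate]: n is the size of the cofactor V of g^(k-1) in the
    Wronskian, and (X - xi)^(J-1), of size J, cannot divide V once n < J. *)
Lemma zero_estimate_arith (N r k n J : nat) :
    (0 < k)%N -> (n + k.-1 * r <= 2 * N - 2)%N -> (2 * N + r <= J + k * r)%N ->
    (0 < n)%N ->
  (2 < J)%N /\ (n < J.-1.+1)%N.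
Proof. by case: k => // k _ /=; rewrite mulSn; lia. Qed.

Section ZeroEstimate.
Variables (C : numFieldType) (r : nat) (x : C).
Hypotheses (r2 : (2 <= r)%N) (xdeg : algdeg r x).
Local Notation io := (map_poly (ratr : rat -> C)).

Lemma algdeg_dvdp (g G : {poly rat}) :
  size g = r.+1 -> (io g).[x] = 0 -> (io G).[x] = 0 -> g %| G.
Proof.
move=> sg gx Gx; have g0 : g != 0 by rewrite -size_poly_eq0 sg.
apply/modp_eq0P; apply: xdeg.
  by rewrite -ltnS -sg ltn_modp.
have := Gx; rewrite {1}(divp_eq G g) rmorphD rmorphM /= hornerD hornerM gx.
by rewrite mulr0 add0r.
Qed.

Lemma algdeg_neq (q : rat) : x != ratr q.
Proof.
apply/eqP => xq; have := @xdeg ('X - q%:P); rewrite size_XsubC => /(_ r2).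
rewrite rmorphB /= map_polyX map_polyC hornerXsubC xq subrr => /(_ erefl) /eqP.
by rewrite polyXsubC_eq0.
Qed.

Lemma algdeg_neq_horner (g : {poly rat}) (q : rat) :
  size g = r.+1 -> (io g).[x] = 0 -> g.[q] != 0.
Proof.
move=> sg gx; apply/eqP => /eqP /factor_theorem [h gE].
have h0 : h != 0 by apply/eqP => h0; move: sg; rewrite gE h0 mul0r size_poly0.
move: sg gx; rewrite gE size_Mmonic ?monicXsubC // size_XsubC addnS addn1 /=.
case=> sh; rewrite rmorphM rmorphB /= map_polyX map_polyC hornerM hornerXsubC.
move/eqP; rewrite mulf_eq0 subr_eq0 (negPf (algdeg_neq q)) orbF => /eqP.
by move/xdeg; rewrite sh leqnn => /(_ isT) /eqP; rewrite (negPf h0).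
Qed.

(** Here g is the minimal polynomial of x up to a constant, and x is a simple root of it, for
    otherwise g', of degree less than r, would vanish at x. Each factor X - x of G can therefore be
    traded for a factor g. *)
Lemma algdeg_dvdp_exp (g G : {poly rat}) (e : nat) :
    size g = r.+1 -> (io g).[x] = 0 ->
  ('X - x%:P) ^+ e %| io G -> g ^+ e %| G.
Proof.
move=> sg gx; have g0 : g != 0 by rewrite -size_poly_eq0 sg.
have [g1 g1E] := factor_theorem (io g) x (introT eqP gx).
have g1x : ~~ root g1 x.
  apply/negP => /eqP g1x.
  have : g^`() = 0.
    apply: xdeg; first by have := lt_size_deriv g0; rewrite sg ltnS.
    rewrite -deriv_map g1E derivM derivXsubC hornerD !hornerM g1x mul0r.
    by rewrite hornerXsubC subrr mulr0 addr0.
  move=> /(congr1 (fun p : {poly rat} => p`_(r.-1))); rewrite coef_deriv coef0.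
  move/eqP; rewrite mulrn_eq0 /= prednK; last lia.
  have := lead_coef_eq0 g; rewrite lead_coefE sg /= => ->.
  by rewrite (negPf g0).
elim: e G => [|e IH] G dG; first by rewrite expr0 dvd1p.
move: dG; rewrite exprSr => dG.
have Gx : (io G).[x] = 0.
  have := dvdp_trans (dvdp_mull _ (dvdpp _)) dG.
  by rewrite dvdp_XsubCl => /eqP.
have /dvdpP [G1 GE] := algdeg_dvdp sg gx Gx.
rewrite GE exprSr dvdp_mul2r //; apply: IH.
move: dG; rewrite GE rmorphM /= g1E mulrA dvdp_mul2r ?polyXsubC_eq0 //.
by rewrite Gauss_dvdpl // coprimep_expl // coprimep_sym coprimep_XsubC.
Qed.

Lemma map_poly_int_rat (A : {poly int}) :
  io (map_poly intr A) = map_poly intr A.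
Proof.
by rewrite -map_poly_comp; apply: eq_map_poly => i /=; rewrite ratr_int.
Qed.

(* If A - cB vanishes to high order at xi, so does the Wronskian of A and B,
   which is divisible by g^(k-1) and hence has no room for these zeros. *)
Lemma zero_estimate (f A B : {poly int}) (N k J : nat) (xi c : rat) :
    size f = r.+1 -> (map_poly intr f).[x] = 0 ->
    (A != 0) || (B != 0) -> (size A <= N)%N -> (size B <= N)%N ->
    (0 < k)%N -> (N <= k * r)%N -> (2 * N + r <= J + k * r)%N ->
    (forall j, (j < k)%N -> (map_poly intr A)^`N(j).[x]
      = x * (map_poly intr B)^`N(j).[x] :> C) ->
  exists2 j, (j < J)%N &
    (map_poly intr A)^`N(j).[xi] != c * (map_poly intr B)^`N(j).[xi].
Proof.
move=> sf fx AB0 sA sB k0 Nk NJ vanish.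
set g : {poly rat} := map_poly intr f.
set a : {poly rat} := map_poly intr A; set b : {poly rat} := map_poly intr B.
have sz (P : {poly int}) : size (map_poly intr P : {poly rat}) = size P.
  by rewrite size_map_inj_poly //; apply: intr_inj.
have sg : size g = r.+1 by rewrite sz.
have g0 : g != 0 by rewrite -size_poly_eq0 sg.
have gx : (io g).[x] = 0 by rewrite map_poly_int_rat.
have sa : (size a <= N)%N by rewrite sz.
have sb : (size b <= N)%N by rewrite sz.
have sgk e : size (g ^+ e) = (e * r).+1.
  have : (0 < size (g ^+ e)%R)%N by rewrite size_poly_gt0 expf_neq0.
  by move=> h; rewrite -[LHS]prednK // size_exp sg mulnC.
have dQ : ('X - x%:P) ^+ k %| io a - x *: io b.
  apply: dvdp_nderivn => j jk; rewrite nderivnB nderivnZ hornerD hornerN hornerZ.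
  by rewrite !map_poly_int_rat vanish // subrr.
have small (P : {poly rat}) : ('X - x%:P) ^+ k %| io P -> (size P <= N)%N -> P = 0.
  move=> dP sP; apply/eqP; apply: contraT => P0.
  by have := dvdp_leq P0 (algdeg_dvdp_exp sg gx dP); rewrite sgk ltnNge (leq_trans sP Nk).
have b0 : b != 0.
  apply/eqP => b0; have a0 : a = 0.
    by apply: small => //; move: dQ; rewrite b0 rmorph0 scaler0 subr0.
  move: AB0; rewrite -!size_poly_eq0 -!sz -/a -/b a0 b0.
  by rewrite !size_poly0.
have dep d : a != d *: b.
  apply/eqP => aE; move: dQ; rewrite aE linearZ /= -scalerBl dvdpZr.
    by move/small/(_ sb)/eqP; rewrite (negPf b0).
  by rewrite subr_eq0 eq_sym algdeg_neq.
set W := a * b^`() - a^`() * b.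
have W0 : W != 0.
  apply/eqP => /eqP; rewrite subr_eq0 => /eqP Weq.
  have a0 : a != 0 by have := dep 0; rewrite scale0r.
  have sab := wronskian0_size a0 b0 Weq.
  (* Subtracting d b cancels the leading coefficient of a, yet a - d b still has zero Wronskian with
     b and must keep the size of b: a contradiction. *)
  pose d := lead_coef a / lead_coef b.
  have a10 : a - d *: b != 0 by rewrite subr_eq0.
  have := wronskian0_size a10 b0.
  have -> : (a - d *: b) * b^`() = (a - d *: b)^`() * b.
    by rewrite derivB derivZ !mulrBl Weq -!scalerAl [b * _]mulrC.
  move=> /(_ erefl) s1.
  have : lead_coef (a - d *: b) = 0.
    rewrite lead_coefE s1 coefB coefZ -{1}sab -!lead_coefE /d.
    by rewrite divfK ?subrr // lead_coef_eq0.
  by move/eqP; rewrite lead_coef_eq0 (negPf a10).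
have dW : g ^+ k.-1 %| W.
  apply: algdeg_dvdp_exp => //.
  have -> : io W = (io a - x *: io b) * io b^`() - (io a - x *: io b)^`() * io b.
    rewrite /W derivB -!mul_polyC derivM derivC mul0r add0r !deriv_map rmorphB.
    by rewrite !rmorphM /=; ring.
  rewrite dvdp_sub // dvdp_mulr //.
    by apply: dvdp_trans dQ; rewrite dvdp_exp2l // leq_pred.
  by apply: dvdp_XsubC_deriv; rewrite prednK.
have [V WE] := dvdpP _ _ dW.
have V0 : V != 0 by apply: contraNneq W0 => V0; rewrite WE V0 mul0r.
have sd (p : {poly rat}) : (size p <= N)%N -> (size p^`() <= N.-1)%N.
  have [->|p0] := eqVneq p 0; first by rewrite deriv0 size_poly0.
  by move=> sp;
    rewrite -ltnS (leq_trans (lt_size_deriv p0)) // (leq_trans sp) // leqSpred.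
have sM (p q : {poly rat}) : (size p <= N)%N -> (size q <= N.-1)%N ->
    (size (p * q)%R <= 2 * N - 2)%N.
  move=> sp sq; apply: leq_trans (size_polyMleq p q) _.
  by rewrite -subn1 leq_subLR (leq_trans (leq_add sp sq)) //; clear; lia.
have sW : (size W <= 2 * N - 2)%N.
  apply: leq_trans (size_polyD _ _) _; rewrite size_polyN geq_max.
  by rewrite sM ?sd // mulrC sM ?sd.
have sV : (size V + k.-1 * r <= 2 * N - 2)%N.
  by move: sW; rewrite WE size_mul ?expf_neq0 // sgk addnS.
have [/exists_inP [j _ hj]|] :=
  boolP [exists (j : 'I_J | true), a^`N(j).[xi] != c * b^`N(j).[xi]].
  by exists j.
rewrite negb_exists_in => /forall_inP none; exfalso.
(* If all J values agree, (X - xi)^(J-1) divides W. It is coprime to g, which has no rational root,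
   so it divides the small cofactor V. *)
have dc : ('X - xi%:P) ^+ J %| a - c *: b.
  apply: dvdp_nderivn => j jJ; rewrite nderivnB nderivnZ hornerD hornerN hornerZ.
  by have := none (Ordinal jJ) isT; rewrite negbK => /eqP ->; rewrite subrr.
have V1 : (0 < size V)%N by rewrite size_poly_gt0.
have [J2 nJ] := zero_estimate_arith k0 sV NJ V1.
have J0 : (0 < J)%N by apply: leq_trans J2.
have : ('X - xi%:P) ^+ J.-1 %| W.
  have -> : W = (a - c *: b) * b^`() - (a - c *: b)^`() * b.
    by rewrite /W derivB -!mul_polyC derivM derivC mul0r add0r; ring.
  rewrite dvdp_sub // dvdp_mulr //.
    by apply: dvdp_trans dc; rewrite dvdp_exp2l // leq_pred.
  by apply: dvdp_XsubC_deriv; rewrite prednK.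
rewrite WE Gauss_dvdpl; last first.
  rewrite coprimep_expl // coprimep_expr // coprimep_sym coprimep_XsubC.
  exact: algdeg_neq_horner.
by move/(dvdp_leq V0); rewrite size_exp_XsubC leqNgt nJ.
Qed.
End ZeroEstimate.

(** * Thue's inequality *)

Section HornerBounds.
Variable R : realType.
Implicit Types (P : {poly R[i]}) (z : R[i]).

Lemma nderivn_nderivn (K : nzSemiRingType) (P : {poly K}) (i j : nat) :
  (P^`N(j))^`N(i) = P^`N(i + j) *+ 'C(i + j, j).
Proof.
apply/polyP => m; rewrite coefMn !coef_nderivn -!mulrnA.
have -> : (j + (i + m) = i + j + m)%N by lia.
congr (_ *+ _).
have f1 : ('C(i + j + m, j) * (j`! * (i + m)`!) = (i + j + m)`!)%N.
  by rewrite (_ : i + m = i + j + m - j)%N ?bin_fact //; lia.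
have f2 : ('C(i + m, i) * (i`! * m`!) = (i + m)`!)%N.
  by have := @bin_fact (i + m) i (leq_addr _ _); rewrite addKn.
have f3 : ('C(i + j + m, i + j) * ((i + j)`! * m`!) = (i + j + m)`!)%N.
  by have := @bin_fact (i + j + m) (i + j) (leq_addr _ _); rewrite addKn.
have f4 : ('C(i + j, j) * (j`! * i`!) = (i + j)`!)%N.
  by have := @bin_fact (i + j) j (leq_addl _ _); rewrite addnK.
have F0 : (0 < j`! * (i`! * m`!))%N by rewrite !muln_gt0 !fact_gt0.
apply/eqP; rewrite -(eqn_pmul2r F0); apply/eqP.
rewrite -mulnA [('C(i + m, i) * _)%N]mulnCA f2 f1 -f3 -f4.
by rewrite -!mulnA; congr (_ * _)%N; rewrite [in RHS]mulnCA.
Qed.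

Lemma nc_horner_le P z (N : nat) (c Z : R) :
    (size P <= N)%N -> (forall i, nc P`_i <= c) -> 1 <= Z -> nc z <= Z ->
  nc P.[z] <= N%:R * c * Z ^+ N.
Proof.
move=> sP cP Z1 zZ; rewrite (horner_coef_wide _ sP).
apply: le_trans (nc_sum _ _ _) _.
have c0 : 0 <= c by apply: le_trans (cP 0%N); exact: nc_ge0.
rewrite -mulrA mulr_natl -[N in _ *+ N]card_ord -sumr_const; apply: ler_sum => i _.
rewrite ncM ncX ler_pM ?exprn_ge0 ?nc_ge0 //.
apply: le_trans (_ : Z ^+ i <= _); first by rewrite lerXn2r ?nnegrE ?nc_ge0 //; lra.
by rewrite ler_weXn2l // ltnW.
Qed.

Lemma nc_coef_nderivn_le P (N j : nat) (c : R) :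
    (size P <= N)%N -> (forall i, nc P`_i <= c) ->
  forall i, nc (P^`N(j))`_i <= 2 ^+ N * c.
Proof.
move=> sP cP i; rewrite coef_nderivn -[_ *+ 'C(_, _)]mulr_natr ncM nc_nat mulrC.
have [jiN|Nji] := ltnP (j + i) N; last first.
  rewrite nth_default ?nc0 ?mulr0; last exact: leq_trans Nji.
  by rewrite mulr_ge0 ?exprn_ge0 // (le_trans _ (cP 0%N)) ?nc_ge0.
rewrite ler_pM ?nc_ge0 // -natrX ler_nat (leq_trans (bin_le_exp2 _ _)) //.
by rewrite leq_pexp2l // ltnW.
Qed.

Lemma nc_nderivn_near P (x z : R[i]) (N k j : nat) (c Z : R) :
    (size P <= N)%N -> (forall i, nc P`_i <= c) -> 1 <= Z -> nc x <= Z ->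
    (forall i, (i < k)%N -> P^`N(i).[x] = 0) -> nc (x - z) <= 1 -> (j <= k)%N ->
  nc P^`N(j).[z] <= 16 ^+ N * c * Z ^+ N * nc (x - z) ^+ (k - j).
Proof.
move=> sP cP Z1 xZ vanish xz1 jk.
have c0 : 0 <= c by apply: le_trans (cP 0%N); exact: nc_ge0.
have sP' : (size P^`N(j) <= N)%N.
  apply/leq_sizeP => i Ni; rewrite coef_nderivn nth_default ?mul0rn //.
  by apply: leq_trans sP _; lia.
have zE : z = x + (z - x) by ring.
rewrite {1}zE (nderiv_taylor_wide (mulrC _ _) sP').
apply: le_trans (nc_sum _ _ _) _.
have N2 : (N%:R : R) <= 2 ^+ N.
  by rewrite -natrX ler_nat ltnW // ltn_expl.
have dZ : nc (z - x) = nc (x - z) by rewrite -ncN opprB.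
(* The 16^N is made of four factors 2^N: two bound the binomial coefficients of the two successive
   derivatives, one the N of [nc_horner_le], one the number of Taylor terms. Only the terms with i +
   j >= k survive, and they carry |x - z|^(k - j). *)
set B := 2 ^+ N * (2 ^+ N * (2 ^+ N * c)) * Z ^+ N * nc (x - z) ^+ (k - j).
have B0 : 0 <= B by rewrite !mulr_ge0 ?exprn_ge0 ?nc_ge0 //; lra.
apply: le_trans (_ : \sum_(i < N) B <= _).
  apply: ler_sum => i _; rewrite ncM ncX dZ.
  have [ijk|kij] := ltnP (i + j) k.
    by rewrite nderivn_nderivn hornerMn vanish // mul0rn nc0 mul0r.
  rewrite /B ler_pM ?exprn_ge0 ?nc_ge0 //.
    apply: le_trans (nc_horner_le (N := N) (c := 2 ^+ N * (2 ^+ N * c)) _ _ Z1 xZ) _.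
    - apply/leq_sizeP => m Nm; rewrite coef_nderivn nth_default ?mul0rn //.
      by apply: leq_trans sP' _; lia.
    - by apply: nc_coef_nderivn_le => //; apply: nc_coef_nderivn_le.
    - by rewrite !ler_wpM2r ?exprn_ge0 // ?mulr_ge0 ?exprn_ge0 //; lra.
  rewrite ler_wiXn2l ?nc_ge0 //; lia.
rewrite sumr_const card_ord -[_ *+ N]mulr_natl /B.
have -> : (16 : R) ^+ N = 2 ^+ N * 2 ^+ N * 2 ^+ N * 2 ^+ N.
  by rewrite -!exprMn; congr (_ ^+ _); ring.
rewrite !mulrA !ler_wpM2r ?exprn_ge0 ?nc_ge0 //; lra.
Qed.

(** The same integer m serves all fields K: nonvanishing is known over [rat], while the absolute
    value is taken in [R[i]]. *)
Lemma horner_intr_ratio (P : {poly int}) (N : nat) (p q : int) :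
    (size P <= N.+1)%N -> q != 0 ->
  exists m : int, forall K : numFieldType,
    (map_poly intr P).[p%:~R / q%:~R] * q%:~R ^+ N = m%:~R :> K.
Proof.
move=> sP q0; exists (\sum_(i < N.+1) P`_i * p ^+ i * q ^+ (N - i)) => K.
rewrite (@horner_coef_wide _ N.+1); last by apply: leq_trans (size_poly _ _) sP.
rewrite mulr_suml rmorph_sum; apply: eq_bigr => i _; rewrite coef_map /=.
have -> : (q%:~R : K) ^+ N = q%:~R ^+ i * q%:~R ^+ (N - i).
  by rewrite -exprD subnKC // -ltnS.
rewrite expr_div_n !rmorphM !rmorphXn /=.
have : (q%:~R : K) ^+ i != 0 by rewrite expf_neq0 // intr_eq0.
by move=> qi; field.
Qed.

Lemma thue_lower (A B : {poly int}) (N j : nat) (p1 q1 p2 q2 : int) :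
    (size A <= N.+1)%N -> (size B <= N.+1)%N -> 0 < q1 -> 0 < q2 ->
    (map_poly intr A)^`N(j).[p1%:~R / q1%:~R]
      != p2%:~R / q2%:~R * (map_poly intr B)^`N(j).[p1%:~R / q1%:~R] :> rat ->
  1 <= q1%:~R ^+ N * q2%:~R * nc ((map_poly intr A)^`N(j).[p1%:~R / q1%:~R]
      - p2%:~R / q2%:~R * (map_poly intr B)^`N(j).[p1%:~R / q1%:~R] : R[i]).
Proof.
move=> sA sB q10 q20; rewrite !nderivn_map.
have sD (P : {poly int}) : (size P <= N.+1)%N -> (size P^`N(j) <= N.+1)%N.
  move=> sP; apply/leq_sizeP => i Ni; rewrite coef_nderivn nth_default ?mul0rn //.
  by apply: leq_trans sP _; lia.
move/sD: sA; move/sD: sB; move: (A^`N(j)) (B^`N(j)) => {}A {}B sB sA.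
have [m mE] : exists m : int, forall K : numFieldType,
    ((map_poly intr A).[p1%:~R / q1%:~R]
      - p2%:~R / q2%:~R * (map_poly intr B).[p1%:~R / q1%:~R])
    * (q1%:~R ^+ N * q2%:~R) = m%:~R :> K.
  have [a aE] := horner_intr_ratio p1 sA (lt0r_neq0 q10).
  have [b bE] := horner_intr_ratio p1 sB (lt0r_neq0 q10).
  exists (a * q2 - p2 * b) => K; rewrite rmorphB !rmorphM /= -aE -bE.
  have : (q2%:~R : K) != 0 by rewrite intr_eq0 lt0r_neq0.
  by move=> q2K; field.
move=> neq; have m0 : m != 0.
  rewrite -(intr_eq0 rat) -mE mulf_neq0 ?subr_eq0 //.
  by rewrite mulf_neq0 ?expf_neq0 ?intr_eq0 ?gt_eqF.
have := @nc_int_ge1 R m m0; rewrite -mE !ncM ncX !nc_int.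
by rewrite mulrC !gtr0_norm.
Qed.

End HornerBounds.

Section Thue.
Variable R : realType.

(** Write z_i = p_i / q_i. For the j given by the zero estimate, A^(j)(z_1) - z_2 B^(j)(z_1) is a
    nonzero rational of denominator dividing q_1^N q_2. It also equals (A - x B)^(j)(z_1) + (x -
    z_2) B^(j)(z_1), whose first term is small by the order of vanishing at x and whose second is
    small because z_2 is close to x. *)
Lemma thue_ineq (f : {poly int}) (r H N k w J : nat) (x : R[i])
    (p1 q1 p2 q2 : int) (Z : R) :
    (2 <= r)%N -> algdeg r x -> size f = r.+1 -> (map_poly intr f).[x] = 0 ->
    (0 < H)%N -> (forall i, `|f`_i| <= H%:Z) ->
    (k * r < 2 * N)%N -> (k * r <= w * (2 * N - k * r))%N ->
    (0 < k)%N -> (N <= k * r)%N -> (2 * N + r <= J + k * r)%N -> (J <= k)%N ->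
    0 < q1 -> 0 < q2 -> 1 + nc x <= Z ->
    nc (x - p1%:~R / q1%:~R) <= 1 ->
  1 <= q1%:~R ^+ N * q2%:~R * ((4 * N * (4 * H) ^ N) ^ w)%N%:R
       * (16 ^+ N * Z ^+ N.+1)
       * (nc (x - p1%:~R / q1%:~R) ^+ (k - J) + nc (x - p2%:~R / q2%:~R)).
Proof.
move=> r2 xdeg sf fx H0 fH kN kw k0 Nk NJ Jk q10 q20 xZ d1.
set X := ((4 * N * (4 * H) ^ N) ^ w)%N.
set z1 := p1%:~R / q1%:~R; set z2 := p2%:~R / q2%:~R.
have r0 : (0 < r)%N by lia.
have [A [B [AB0 /andP [sA sB] AB_le vanish]]] := aux_poly r0 sf fx H0 fH kN kw.
have [j jJ neq] := zero_estimate r2 xdeg (p1%:~R / q1%:~R) (p2%:~R / q2%:~R)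
  sf fx AB0 sA sB k0 Nk NJ vanish.
have := thue_lower R (leqW sA) (leqW sB) q10 q20 neq.
rewrite -/z1 -/z2; set a := map_poly intr A; set b := map_poly intr B.
have nx := nc_ge0 x.
have Z1 : 1 <= Z by lra.
have xleZ : nc x <= Z by lra.
have z1Z : nc z1 <= Z.
  have -> : z1 = x - (x - z1) by ring.
  by apply: le_trans (ncB _ _) _; rewrite -/z1 in d1; lra.
have sa : (size a <= N)%N by apply: leq_trans (size_poly _ _) sA.
have sb : (size b <= N)%N by apply: leq_trans (size_poly _ _) sB.
have cE (P : {poly int}) : (forall i, `|P`_i| <= X%:Z) ->
    forall i, nc ((map_poly intr P : {poly R[i]})`_i) <= X%:R.
  by move=> hP i; rewrite coef_map nc_int /= -[X%:R]/((Posz X)%:~R) ler_int.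
have ca := cE A (fun i => (AB_le i).1); have cb := cE B (fun i => (AB_le i).2).
have X0 : 0 <= X%:R :> R by exact: ler0n.
have e : a^`N(j).[z1] - z2 * b^`N(j).[z1] =
   (a - x *: b)^`N(j).[z1] + (x - z2) * b^`N(j).[z1].
  by rewrite nderivnB nderivnZ hornerD hornerN hornerZ; ring.
have t1 : nc (a - x *: b)^`N(j).[z1] <=
    16 ^+ N * (X%:R * Z) * Z ^+ N * nc (x - z1) ^+ (k - J).
  apply: le_trans (nc_nderivn_near (N := N) (k := k) (c := X%:R * Z) _ _ Z1 xleZ _ d1
    _) _.
  - apply: leq_trans (size_polyD _ _) _; rewrite size_polyN geq_max sa.
    by apply: leq_trans (size_scale_leq _ _) sb.
  - move=> i; rewrite coefB coefZ; apply: le_trans (ncB _ _) _; rewrite ncM.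
    have := ca i; have := cb i; rewrite -/a -/b => h1 h2.
    have : nc x * nc b`_i <= nc x * X%:R by rewrite ler_wpM2l.
    have : (1 + nc x) * X%:R <= Z * X%:R by rewrite ler_wpM2r.
    lra.
  - move=> i ik; rewrite nderivnB nderivnZ hornerD hornerN hornerZ.
    by rewrite /a /b vanish // subrr.
  - exact: ltnW (leq_trans jJ Jk).
  apply: ler_wpM2l; first by rewrite !mulr_ge0 ?exprn_ge0 //; lra.
  by rewrite ler_wiXn2l ?nc_ge0 // leq_sub2l // ltnW.
have t2 : nc b^`N(j).[z1] <= 16 ^+ N * (X%:R * Z) * Z ^+ N.
  apply: le_trans (nc_horner_le (N := N) (c := 2 ^+ N * X%:R) _ _ Z1 z1Z) _.
  - by apply/leq_sizeP => i Ni; rewrite coef_nderivn nth_default ?mul0rn //;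
      apply: leq_trans sb (leq_trans Ni (leq_addl _ _)).
  - exact: nc_coef_nderivn_le.
  rewrite ler_wpM2r ?exprn_ge0 //; first lra.
  have h16 : N%:R * 2 ^+ N <= 16 ^+ N :> R.
    have -> : (16 : R) ^+ N = 8 ^+ N * 2 ^+ N by rewrite -exprMn; congr (_ ^+ _); ring.
    rewrite ler_wpM2r ?exprn_ge0 // -natrX ler_nat ltnW //.
    by apply: (leq_trans (ltn_expl N (isT : 1 < 2)%N)); case: (N) => // n;
      rewrite leq_exp2r.
  have : N%:R * 2 ^+ N * X%:R <= 16 ^+ N * X%:R :> R by apply: ler_wpM2r.
  have : 16 ^+ N * X%:R * 1 <= 16 ^+ N * X%:R * Z.
    by rewrite ler_wpM2l // mulr_ge0 ?exprn_ge0.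
  by rewrite !mulrA; lra.
have U := le_trans (ncD _ _) (lerD t1 (_ : nc ((x - z2) * b^`N(j).[z1])
  <= nc (x - z2) * (16 ^+ N * (X%:R * Z) * Z ^+ N))).
rewrite -e ncM in U; have {}U := U (ler_wpM2l (nc_ge0 _) t2).
have Q0 : 0 <= q1%:~R ^+ N * q2%:~R :> R.
  by rewrite mulr_ge0 ?exprn_ge0 // ler0z ltW.
move=> low; apply: le_trans (le_trans low (ler_wpM2l Q0 U)) _.
rewrite exprS le_eqVlt; apply/orP; left; apply/eqP; ring.
Qed.

(* With s = ln M, l1 = ln q1, l2 = ln q2: the two terms that bound the value
   of the auxiliary polynomial from above are both too small. *)
Lemma thue_exponents (r T s l1 l2 : R) :
    3 <= r -> r <= T -> 0 < s -> 1000 * r ^+ 2 * s <= l1 ->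
    33 * T * l1 <= l2 -> l2 <= 44 * T * l1 ->
  let N := T * (20 * r + 1) in
  s + N * l1 + l2 + (3 * N + 2 * N * (20 * r)) * s
    + 37 * T * ((r - 1) * s - r * l1) < 0 /\
  s + N * l1 + l2 + (3 * N + 2 * N * (20 * r)) * s
    + ((r - 1) * s - r * l2) < 0.
Proof.
move=> r3 rT s0 h1 h2 h3.
have T3 : 3 <= T by exact: le_trans rT.
have T0 : 0 < T by exact: lt_le_trans T3.
have rr : 3 * r <= r ^+ 2.
  by rewrite expr2 ler_wpM2r // (le_trans _ r3).
have r2s : 9000 * s <= l1.
  have : 9 * s <= r ^+ 2 * s.
    by rewrite ler_wpM2r ?(ltW s0) // (le_trans _ rr) //; move: r3; clear; lra.
  move: h1; rewrite -mulrA; move: (r ^+ 2 * s) => t; clear; lra.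
have l10 : 0 < l1 by apply: lt_le_trans r2s; rewrite mulr_gt0.
have Tl : 0 < T * l1 by rewrite mulr_gt0.
(* The threshold 1000 r^2 s <= l1 is made for this term: (20 r + 1)(40 r + 3) <= 1000 r^2. *)
have b1 : (3 * (T * (20 * r + 1)) + 2 * (T * (20 * r + 1)) * (20 * r)) * s
    <= T * l1.
  rewrite (_ : _ * s = T * ((20 * r + 1) * (40 * r + 3) * s)); last by ring.
  rewrite ler_wpM2l ?(ltW T0) //; apply: le_trans h1; rewrite ler_wpM2r ?(ltW s0) //.
  move: rr r3; clear; lra.
have b2 : r * s <= l1 / 3000.
  have : 3 * r * s <= r ^+ 2 * s by rewrite ler_wpM2r ?(ltW s0).
  move: h1; rewrite -!mulrA; move: (r ^+ 2 * s) (r * s) => t u; clear; lra.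
have b2' : r * s <= T * l1 / 3000.
  have : 3 * l1 <= T * l1 by rewrite ler_wpM2r ?(ltW l10).
  move: b2 l10; move: (T * l1) (r * s) => t u; clear; lra.
have b3 : T * (r * s) <= T * l1 / 3000.
  by rewrite -mulrA ler_wpM2l // ltW.
have b4 : s <= T * l1 / 20000.
  have : 3 * l1 <= T * l1 by rewrite ler_wpM2r ?(ltW l10).
  move: r2s s0; move: (T * l1) => t; clear; lra.
have b5 : 3 * (T * l1) <= r * (T * l1) by rewrite ler_wpM2r ?(ltW Tl).
have b6 : 0 <= T * s by rewrite mulr_ge0 ?(ltW T0) ?(ltW s0).
rewrite -!mulrA in h2 h3; cbv zeta.
have -> : T * (20 * r + 1) * l1 = 20 * (r * (T * l1)) + T * l1 by ring.
have b8 : 33 * (r * (T * l1)) - 33 * (T * l1) <= r * l2 - l2.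
  have : (r - 1) * (33 * (T * l1)) <= (r - 1) * l2.
    by rewrite ler_wpM2l // subr_ge0 (le_trans _ r3) // ler1n.
  by rewrite !mulrBl !mul1r [r * (33 * _)]mulrCA.
have -> : 37 * T * ((r - 1) * s - r * l1) =
    37 * (T * (r * s)) - 37 * (T * s) - 37 * (r * (T * l1)) by ring.
rewrite [(r - 1) * s]mulrBl mul1r.
move: b1 b2' b3 b4 b5 b6 b8 h2 h3 Tl r2s s0.
move: ((3 * (T * (20 * r + 1)) + 2 * (T * (20 * r + 1)) * (20 * r)) * s).
move: (T * (r * s)) (r * s) (T * s) (r * (T * l1)) (r * l2) (T * l1).
move=> x1 x2 x3 x4 x5 x6 x7; clear => b1 b2 b3 b4 b5 b6 b8 h2 h3 Tl r2s s0.
(* The coefficient of T l1 is 20 r + 1 + 44 - 37 r = 45 - 17 r <= -6 in the first sum and at most 20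
   r + 1 - 33 (r - 1) = 34 - 13 r <= -5 in the second. The multiples of s cost little more than T
   l1. *)
by split; [clear b2 b8 r2s h2 s0; lra|clear b3 b4 b6 h2 h3 r2s s0; lra].
Qed.

End Thue.

Section ThueGap.
Variable R : realType.

Lemma thue_const_le (M : R) (H r N w : nat) :
    (0 < r)%N -> (0 < N)%N -> 2 ^+ (20 * r) <= M -> H%:R <= 2 ^+ r * M ->
  ((4 * N * (4 * H) ^ N) ^ w)%N%:R * (16 ^+ N * (2 * M) ^+ N.+1)
    <= M ^+ (3 * N + 2 * N * w) :> R.
Proof.
move=> r0 N0 hM hH.
have pM e : (e <= 20 * r)%N -> 2 ^+ e <= M.
  by move=> he; apply: le_trans hM; rewrite ler_weXn2l // ler1n.
have M1 : 1 <= M by rewrite -(expr0 2) pM.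
have M0 : 0 <= M by apply: le_trans M1.
rewrite exprD mulrC; apply: ler_pM; rewrite ?mulr_ge0 ?exprn_ge0 ?ler0n //.
- by rewrite mulr_ge0.
- apply: le_trans (_ : 16 ^+ N * (2 * M) ^+ (2 * N) <= _).
    rewrite ler_wpM2l ?exprn_ge0 // ler_weXn2l //; last by lia.
    by rewrite (le_trans M1) // ler_peMl // ler1n.
  rewrite exprM [M ^+ (3 * N)]exprM -exprMn lerXn2r ?nnegrE ?mulr_ge0 ?exprn_ge0 //.
  have -> : 16 * (2 * M) ^+ 2 = 2 ^+ 6 * M ^+ 2 by ring.
  by rewrite [M ^+ 3]exprS ler_wpM2r ?exprn_ge0 // pM //; lia.
- rewrite natrX exprM lerXn2r ?nnegrE ?exprn_ge0 //.
  rewrite natrM natrX exprM.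
  have -> : (M ^+ 2) ^+ N = M ^+ N * M ^+ N by rewrite -exprMn expr2.
  have h1 : (4 * N)%:R <= 8 ^+ N :> R.
    rewrite -natrX ler_nat; case: N N0 => // n _; elim: n => // n IH.
    by rewrite expnS; move: IH; lia.
  have h2 : ((4 * H)%N%:R : R) ^+ N <= (4 * (2 ^+ r * M)) ^+ N.
    rewrite lerXn2r ?nnegrE ?ler0n ?mulr_ge0 ?exprn_ge0 //.
    by rewrite natrM ler_wpM2l.
  apply: le_trans (ler_pM (ler0n _ _) _ h1 h2) _; first by rewrite exprn_ge0.
  rewrite -!exprMn lerXn2r ?nnegrE ?mulr_ge0 ?exprn_ge0 //.
  have -> : 8 * (4 * (2 ^+ r * M)) = 2 ^+ (5 + r) * M by rewrite exprD; ring.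
  by rewrite ler_wpM2r // pM //; lia.
Qed.

(* The parameters are k = 40 T (order of vanishing at alpha), N = T (20 r + 1)
   (bound on the sizes of A and B), w = 20 r (exponent in Siegel's lemma) and
   J = 3 T; T is chosen with 33 T <= ln q2 / ln q1 <= 44 T. *)
Lemma thue_sizes (r T : nat) : (3 <= r)%N -> (r <= T)%N ->
  let N := (T * (20 * r + 1))%N in
  (0 < T)%N /\ [/\ (40 * T * r < 2 * N)%N,
    (40 * T * r <= 20 * r * (2 * N - 40 * T * r))%N,
    (N <= 40 * T * r)%N & (2 * N + r <= 3 * T + 40 * T * r)%N].
Proof.
move=> r3 rT N.
have -> : N = (20 * (T * r) + T)%N by rewrite /N mulnDr muln1; congr (_ + _)%N; ring.
have -> : (40 * T * r = 40 * (T * r))%N by ring.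
have -> : (2 * (20 * (T * r) + T) - 40 * (T * r) = 2 * T)%N by lia.
have -> : (20 * r * (2 * T) = 40 * (T * r))%N by ring.
have := leq_mul (leqnn T) (leq_trans (isT : 1 < 3)%N r3).
by split; [|split]; lia.
Qed.

Lemma thue_gap (f : {poly int}) (r : nat) (x : R[i]) (p1 q1 p2 q2 : int) (M : R) :
    (3 <= r)%N -> algdeg r x -> size f = r.+1 -> (map_poly intr f).[x] = 0 ->
    (forall i, `|f`_i|%:~R <= 2 ^+ r * M) -> nc x <= M -> 2 ^+ (20 * r) <= M ->
    0 < q1 -> 0 < q2 ->
    nc (x - p1%:~R / q1%:~R) <= M ^+ r.-1 / q1%:~R ^+ r ->
    nc (x - p2%:~R / q2%:~R) <= M ^+ r.-1 / q2%:~R ^+ r ->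
    1000 * r%:R ^+ 2 * ln M <= ln (q1%:~R : R) ->
    33 * r%:R * ln (q1%:~R : R) <= ln (q2%:~R : R) ->
  False.
Proof.
move=> r3 xdeg sf fx fM xM hM q10 q20 d1 d2 l1 l2.
set a1 : R := q1%:~R; set a2 : R := q2%:~R.
have a10 : 0 < a1 by rewrite ltr0z.
have a20 : 0 < a2 by rewrite ltr0z.
have M2 : 2 <= M.
  have r1 : (0 < 20 * r)%N by rewrite muln_gt0; case: (r) r3.
  apply: le_trans hM; rewrite -(prednK r1) exprS ler_peMr // exprn_ege1 //.
  by rewrite ler1n.
have M0 : 0 < M by apply: lt_le_trans M2.
have lM : 0 < ln M by rewrite ln_gt0 // (lt_le_trans _ M2) // ltr1n.
have r3R : 3 <= r%:R :> R by rewrite ler_nat.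
have r2R : 9 <= r%:R ^+ 2 :> R by rewrite -natrX ler_nat (leq_sqr 3).
have lM1 : ln M <= ln a1.
  apply: le_trans l1; rewrite ler_peMl ?(ltW lM) //.
  by move: r2R; clear; lra.
have la1 : 0 < ln a1 by apply: lt_le_trans lM1.
have Ma1 : M <= a1 by move: lM1; rewrite ler_ln ?posrE.
pose H := (\max_(i < r.+1) absz (f`_i)%R)%N.
have fH i : `|f`_i| <= H%:Z.
  have [ir|ir] := ltnP i r.+1; last by rewrite nth_default ?sf.
  by rewrite -abszE lez_nat (@leq_bigmax _ (fun i : 'I_r.+1 => absz (f`_i)%R)
    (Ordinal ir)).
have H0 : (0 < H)%N.
  have fr : f`_r != 0.
    have := lead_coef_eq0 f; rewrite lead_coefE sf /= => ->.
    by rewrite -size_poly_eq0 sf.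
  have : 0 < `|f`_r| by rewrite normr_gt0.
  by move=> h; have := lt_le_trans h (fH r).
have HM : H%:R <= 2 ^+ r * M.
  have [|i hi] := @bigop.eq_bigmax _ (fun i : 'I_r.+1 => absz (f`_i)%R);
    first by rewrite card_ord.
  by rewrite /H hi natr_absz.
(* The hypothesis ln q2 >= 33 r ln q1 gives T >= r, hence T >= 3 and 33 (T + 1) <= 44 T, which is
   the upper bound on ln q2 / ln q1. *)
pose T := Num.trunc (ln a2 / (33 * ln a1)).
have la2 : 0 <= ln a2 / (33 * ln a1) by rewrite divr_ge0 ?mulr_ge0 ?(ltW la1) //
  (le_trans _ l2) // !mulr_ge0 ?(ltW la1).
have /andP [T1 T2] := truncn_itv la2; rewrite -/T in T1 T2.
have rT : (r <= T)%N.
  by rewrite truncn_ge_nat // ler_pdivlMr ?mulr_gt0 // mulrCA mulrA.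
clearbody T H.
have [T0 [c1 c2 c3 c4]] := thue_sizes r3 rT.
have D1 : nc (x - p1%:~R / q1%:~R) <= 1.
  apply: le_trans d1 _; rewrite ler_pdivrMr ?exprn_gt0 // mul1r.
  apply: le_trans (_ : M ^+ r <= _).
    by rewrite ler_weXn2l ?leq_pred // (le_trans _ M2) // ler1n.
  by rewrite lerXn2r ?nnegrE // ltW.
have k0 : (0 < 40 * T)%N by rewrite muln_gt0.
have Jk : (3 * T <= 40 * T)%N by rewrite leq_mul2r orbT.
have xZ : 1 + nc x <= 2 * M by move: M2 xM; clear; lra.
have := thue_ineq p2 (ltnW r3) xdeg sf fx H0 fH c1 c2 k0 c3 c4 Jk q10 q20
  xZ D1.
have -> : (40 * T - 3 * T = 37 * T)%N by rewrite -mulnBl.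
set N := (T * (20 * r + 1))%N; rewrite -/a1 -/a2 => low.
have N0 : (0 < N)%N by rewrite muln_gt0 T0 addn1.
have cst := thue_const_le (20 * r) (ltnW (ltnW r3)) N0 hM HM.
set e := (3 * N + 2 * N * (20 * r))%N in cst.
set v1 := M ^+ r.-1 / a1 ^+ r in d1; set v2 := M ^+ r.-1 / a2 ^+ r in d2.
have v10 : 0 < v1 by rewrite divr_gt0 ?exprn_gt0.
have v20 : 0 < v2 by rewrite divr_gt0 ?exprn_gt0.
have {}low : 1 <= a1 ^+ N * a2 * M ^+ e * (v1 ^+ (37 * T) + v2).
  apply: le_trans low _; rewrite -[_ * _ * (16 ^+ N * _)]mulrA.
  apply: ler_pM.
  - rewrite !mulr_ge0 ?exprn_ge0 ?ler0n ?(ltW a10) ?(ltW a20) //.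
    by rewrite mulr_ge0 // ltW.
  - by rewrite addr_ge0 ?exprn_ge0 ?nc_ge0.
  - by rewrite ler_wpM2l // mulr_ge0 ?exprn_ge0 // ltW.
  - by rewrite lerD // lerXn2r ?nnegrE ?nc_ge0 // ltW.
set s := ln M in lM l1 lM1 *; set b1 := ln a1 in l1 l2 la1 lM1 T1 T2 *.
set b2 := ln a2 in l2 T1 T2 *.
have lv (a : R) : 0 < a -> ln (M ^+ r.-1 / a ^+ r) = (r%:R - 1) * s - r%:R * ln a.
  move=> a0; rewrite ln_div ?posrE ?exprn_gt0 // !lnXn // -[_ *+ r]mulr_natl.
  rewrite -[_ *+ r.-1]mulr_natl; congr (_ * _ - _).
  by rewrite -subn1 natrB // (leq_trans _ r3).
have h33 : 0 < 33 * b1 by rewrite mulr_gt0.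
have [] := @thue_exponents R r%:R T%:R s b1 b2.
- by [].
- by rewrite ler_nat.
- by [].
- by [].
- by move: T1; rewrite ler_pdivlMr // mulrCA mulrA.
- move: T2; rewrite ltr_pdivrMr // => /ltW /le_trans; apply.
  rewrite -natr1 mulrA ler_wpM2r ?(ltW la1) //.
  have : 3 <= T%:R :> R by rewrite ler_nat (leq_trans r3).
  by clear; lra.
have NE : T%:R * (20 * r%:R + 1) = N%:R :> R by rewrite /N natrM natrD natrM.
have eE : 3 * N%:R + 2 * N%:R * (20 * r%:R) = e%:R :> R.
  by rewrite /e natrD !natrM.
rewrite NE eE => e1 e2.
(* The lone summand s of the exponent pays for a factor 2 <= M, so each of the two terms is below
   1/2 and their sum cannot reach 1. *)
have half (v : R) : 0 < v ->
    s + N%:R * b1 + b2 + e%:R * s + ln v < 0 -> 2 * (a1 ^+ N * a2 * M ^+ e * v) < 1.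
  move=> v0 hv; have P0 : 0 < a1 ^+ N * a2 * M ^+ e * v.
    by rewrite !mulr_gt0 ?exprn_gt0.
  apply: le_lt_trans (ler_wpM2r (ltW P0) M2) _.
  rewrite -ltr_ln ?posrE ?mulr_gt0 ?exprn_gt0 // ln1.
  rewrite !lnM ?posrE ?mulr_gt0 ?exprn_gt0 // !lnXn //.
  rewrite -[_ *+ N]mulr_natl -[_ *+ e]mulr_natl; apply: le_lt_trans hv.
  by rewrite le_eqVlt; apply/orP; left; apply/eqP; rewrite /s /b1 /b2; ring.
have := half _ v20; rewrite lv // -/s -/b2 => /(_ e2) H2.
have := half _ (exprn_gt0 (37 * T) v10).
rewrite lnXn // lv // -/s -/b1 -[_ *+ (37 * T)]mulr_natl [(37 * T)%:R]natrM.
move=> /(_ e1) H1.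
move: low H1 H2; rewrite mulrDr; move: (_ * v1 ^+ _) (_ * v2) => y z; clear; lra.
Qed.

End ThueGap.

(** * Small solutions *)

Definition det2 (u v : int * int) : int := u.1 * v.2 - u.2 * v.1.

Lemma det2_neq0 (p q : int * int) :
  coprimez p.1 p.2 -> coprimez q.1 q.2 -> 0 < p.2 -> 0 < q.2 -> p != q ->
  det2 p q != 0.
Proof.
case: p q => [p1 p2] [q1 q2] /= cp cq p0 q0; apply: contraNneq => /eqP.
rewrite /det2 /= subr_eq0 => /eqP e.
have d1 : (p2 %| q2)%Z.
  by rewrite -(Gauss_dvdzr (n := p1)) 1?coprimez_sym // e dvdz_mulr.
have d2 : (q2 %| p2)%Z.
  by rewrite -(Gauss_dvdzr (n := q1)) 1?coprimez_sym // [q1 * _]mulrC -e dvdz_mull.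
have e2 : p2 = q2.
  move: d1 d2; rewrite !dvdzE => d1 d2.
  have : absz p2 = absz q2 by apply/eqP; rewrite eqn_dvd d1.
  by move: p0 q0; clear; lia.
move: e; rewrite e2 mulrC => /(mulfI (lt0r_neq0 q0)) ->.
by rewrite eqxx.
Qed.

Lemma coprimez_basis (p : int * int) : coprimez p.1 p.2 -> 0 < p.2 ->
  exists2 q, det2 p q = 1 & 0 <= q.2 <= p.2.
Proof.
case: p => x y /= cp y0; have [u [v uv]] := Bezoutz x y.
have {}uv : u * x + v * y = 1 by rewrite uv; apply/eqP; exact: cp.
have ymod : 0 <= (u %% y)%Z < y by rewrite modz_ge0 ?ltz_pmod // lt0r_neq0.
exists (- v - (u %/ y)%Z * x, (u %% y)%Z).
  rewrite /det2 /= -uv [in RHS](divz_eq u y); ring.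
by case/andP: ymod => -> /ltW.
Qed.

Lemma prod_belast (R : realType) (g : int * int -> R) (x : int * int)
    (s : seq (int * int)) :
    (forall p, p \in x :: s -> 0 <= g p) ->
    path (fun p q => g p * p.2%:~R <= q.2%:~R) x s ->
  (\prod_(p <- belast x s) g p) * x.2%:~R <= (last x s).2%:~R.
Proof.
elim: s x => [|y s IH] x g0 /=; first by rewrite big_nil mul1r.
case/andP => xy ps; rewrite big_cons mulrAC mulrC.
apply: le_trans (IH y _ ps); last by move=> p ps'; apply: g0; rewrite inE ps' orbT.
rewrite ler_wpM2l // big_seq; apply: prodr_ge0 => p /mem_belast ps'.
by apply: g0; rewrite inE ps' orbT.
Qed.

Section SmallSolutions.
Variables (R : realType).
Implicit Types (l : R[i] * R[i]) (p q u v : int * int).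

Definition lf l p : R[i] := l.1 * p.1%:~R + l.2 * p.2%:~R.

(* The form l in the coordinates (s, t) of the point s u + t v. *)
Definition lsubst l u v : R[i] * R[i] := (lf l u, lf l v).

Definition height r (L : 'I_r -> R[i] * R[i]) : R :=
  \prod_i Num.max (nc (L i).1) (nc (L i).2).

Definition lroot l : R[i] := - l.2 / l.1.

(* The inverse of y^2 |alpha - x/y|, for alpha the root of l. *)
Definition closeness l p : R := (p.2%:~R * nc (p.1%:~R - lroot l * p.2%:~R))^-1.

Lemma lf_root l p : l.1 != 0 -> lf l p = l.1 * (p.1%:~R - lroot l * p.2%:~R).
Proof. by move=> l0; rewrite /lf /lroot; field. Qed.

(** Complete p to a basis p, q with 0 <= q.2 <= p.2. From p.2 L(q) = q.2 L(p) - L.1 one gets |L(q)|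
    <= |L(p)| + |L.1| / p.2, and the right-hand side is |L(p)| (1 + t) for the closeness t. The
    height in this basis is thus at most the product of the |L_i(p)| (1 + t_i). *)
Lemma height_le_closeness r (L : 'I_r -> R[i] * R[i]) (m h : R) p :
    (forall i, (L i).1 != 0) -> (forall i, lf (L i) p != 0) ->
    (forall u v, det2 u v = 1 -> m <= height (fun i => lsubst (L i) u v)) ->
    coprimez p.1 p.2 -> 0 < p.2 -> nc (\prod_i lf (L i) p) <= h ->
  m <= h * \prod_i (1 + closeness (L i) p).
Proof.
move=> L1 Lp minm cp p0 ph; have [q pq /andP [q0 qp]] := coprimez_basis cp p0.
apply: le_trans (minm _ _ pq) _.
have pR : 0 < p.2%:~R :> R by rewrite ltr0z.
apply: le_trans (_ : \prod_i (nc (lf (L i) p) * (1 + closeness (L i) p)) <= _);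
  last first.
  rewrite big_split /= -nc_prod ler_wpM2r // prodr_ge0 // => i _.
  by rewrite addr_ge0 // invr_ge0 mulr_ge0 ?nc_ge0 // ltW.
apply: ler_prod => i _; rewrite le_max nc_ge0 /=; rewrite /lsubst /=.
have Lp0 : 0 < nc (lf (L i) p) by rewrite nc_gt0.
have c0 : 0 <= closeness (L i) p by rewrite invr_ge0 mulr_ge0 ?nc_ge0 // ltW.
rewrite ge_max; apply/andP; split; first by rewrite ler_peMr ?nc_ge0 // lerDl.
have e : p.2%:~R * lf (L i) q = q.2%:~R * lf (L i) p - (L i).1.
  have : (p.1%:~R * q.2%:~R - p.2%:~R * q.1%:~R = 1 :> R[i]).
    by rewrite -!rmorphM -rmorphB /= -[RHS]/(1%:~R) -pq.
  rewrite /lf; move: p.1%:~R p.2%:~R q.1%:~R q.2%:~R => a b c d e1.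
  by rewrite -[X in _ - X]mulr1 -e1; ring.
have e2 : nc (L i).1 = nc (lf (L i) p) * (p.2%:~R * closeness (L i) p).
  rewrite /closeness lf_root // ncM; set n := nc (_ - _).
  have n0 : n != 0.
    by rewrite nc_eq0; apply: contraNneq (Lp i) => h0; rewrite lf_root // h0 mulr0.
  by have p2 := lt0r_neq0 pR; field; rewrite n0.
rewrite -(ler_pM2l pR).
have -> : p.2%:~R * nc (lf (L i) q) = nc (p.2%:~R * lf (L i) q).
  by rewrite ncM nc_int gtr0_norm.
rewrite e; apply: le_trans (ncB _ _) _; rewrite e2 ncM nc_int ger0_norm //.
rewrite mulrDr mulr1 mulrDr lerD // ; last by rewrite mulrCA.
by rewrite mulrC [p.2%:~R * _]mulrC ler_wpM2l ?nc_ge0 // ler_int.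
Qed.

(** The nonzero integer [det2 p q] is a combination of the two errors x - alpha y with coefficients
    q.2 and p.2. The error of q contributes at most 1/2, so that of p contributes at least 1/2. *)
Lemma closeness_gap l p q :
    coprimez p.1 p.2 -> coprimez q.1 q.2 -> 0 < p.2 -> p.2 <= q.2 -> p != q ->
    2 <= closeness l p -> 2 <= closeness l q ->
  closeness l p / 2 * p.2%:~R <= q.2%:~R.
Proof.
move=> cp cq p0 pq neq tp tq; have q0 := lt_le_trans p0 pq.
have pR : 0 < p.2%:~R :> R by rewrite ltr0z.
have qR : 0 < q.2%:~R :> R by rewrite ltr0z.
have pqR : p.2%:~R <= q.2%:~R :> R by rewrite ler_int.
have := nc_int_ge1 R (det2_neq0 cp cq p0 q0 neq).
set x := p.1%:~R - lroot l * p.2%:~R; set y := q.1%:~R - lroot l * q.2%:~R.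
have -> : (det2 p q)%:~R = x * q.2%:~R - y * p.2%:~R.
  by rewrite /det2 rmorphB !rmorphM /= /x /y; ring.
move=> h1; have {h1} := le_trans h1 (ncB _ _); rewrite !ncM !nc_int !gtr0_norm //.
have xE : nc x = (p.2%:~R * closeness l p)^-1.
  by rewrite /closeness -/x invfM invrK mulrA mulVf ?mul1r // gt_eqF.
have yE : nc y = (q.2%:~R * closeness l q)^-1.
  by rewrite /closeness -/y invfM invrK mulrA mulVf ?mul1r // gt_eqF.
rewrite xE yE; set t := closeness l p in tp *; set t' := closeness l q in tq *.
have t0 : 0 < t by apply: lt_le_trans tp.
have t'0 : 0 < t' by apply: lt_le_trans tq.
have h2 : (q.2%:~R * t')^-1 * p.2%:~R <= 1 / 2.
  rewrite mulrC ler_pdivrMr ?mulr_gt0 //.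
  apply: le_trans pqR _; rewrite mulrCA ler_peMr ?(ltW qR) //.
  by move: tq; clear; lra.
move=> h1; have : 1 / 2 <= (p.2%:~R * t)^-1 * q.2%:~R.
  by move: h1 h2; move: (_ * q.2%:~R) (_ * p.2%:~R) => a b; clear; lra.
rewrite [_^-1 * _]mulrC ler_pdivlMr ?mulr_gt0 //; congr (_ <= _); ring.
Qed.

End SmallSolutions.

Section SmallCount.
Variable R : realType.
Implicit Types (l : R[i] * R[i]) (p q : int * int) (s : seq (int * int)).

Definition le2 : rel (int * int) := fun p q => p.2 <= q.2.

Lemma path_le2_uniq s x (P : pred (int * int)) (e : rel (int * int)) :
    (forall p q, P p -> P q -> le2 p q -> p != q -> e p q) ->
    all P (x :: s) -> uniq (x :: s) -> path le2 x s ->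
  path e x s.
Proof.
move=> He; elim: s x => //= y s IH x /and3P [Px Py Ps] /and3P [].
rewrite inE negb_or => /andP [xy _] ys us /andP [lexy pys].
by rewrite He //= IH //= ?Py ?Ps ?ys.
Qed.

Lemma sorted_le2 s : sorted le2 (sort le2 s).
Proof. by apply: sort_sorted => p q; rewrite /le2 le_total. Qed.

(* For each root, the product of the gaps telescopes; z is the last solution of
   the chain, the only one without a successor. *)
Lemma small_chain l (Y : R) s :
    uniq s -> 1 <= Y ->
    (forall p, p \in s -> [/\ coprimez p.1 p.2, 0 < p.2 & p.2%:~R <= Y]) ->
  exists z, \prod_(p <- s | (2 <= closeness l p) && (p != z))
    ((1 + closeness l p) / 3) <= Y.
Proof.
move=> us Y1 hs; set g := fun p => (1 + closeness l p) / 3.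
pose P p := [&& coprimez p.1 p.2, 0 < p.2, p.2%:~R <= Y & 2 <= closeness l p].
set s1 := filter (fun p => 2 <= closeness l p) s.
have := sorted_le2 s1; have : all P (sort le2 s1).
  apply/allP => p; rewrite mem_sort mem_filter => /andP [tp /hs [cp p0 pY]].
  exact/and4P.
have : uniq (sort le2 s1) by rewrite sort_uniq filter_uniq.
have big (z : int * int) : \prod_(p <- s | (2 <= closeness l p) && (p != z)) g p =
    \prod_(p <- sort le2 s1 | p != z) g p.
  by rewrite -big_filter_cond; apply: perm_big; rewrite perm_sym perm_sort.
move: big; case: (sort le2 s1) => [|x s2] big us2 Ps2 ss2.
  by exists (0, 0); rewrite big big_nil.
exists (last x s2); rewrite big lastI -cats1 big_cat /= big_cons eqxx /= big_nil mulr1.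
rewrite big_seq_cond.
have -> : \prod_(p <- belast x s2 | (p \in belast x s2) && (p != last x s2)) g p
    = \prod_(p <- belast x s2) g p.
  rewrite [RHS]big_seq; apply: eq_bigl => p; rewrite andbC.
  case: (boolP (p \in _)) => pb; rewrite ?andbF // andbT.
  apply: contraTneq pb => ->; move: us2.
  by rewrite lastI rcons_uniq => /andP [].
have Pg p : P p -> 0 <= g p.
  by case/and4P => _ _ _ t2; rewrite /g; move: t2; clear; lra.
have := @prod_belast _ g x s2 _ _.
have [/and4P [_ x0 _ _] Pl] : P x /\ P (last x s2).
  by split; apply: (allP Ps2); rewrite ?mem_head ?mem_last.
have /and4P [_ _ lY _] := Pl.
have x1 : 1 <= x.2%:~R :> R by rewrite -[1]/(1%:~R) ler_int.
move=> H; apply: le_trans lY; apply: le_trans (H _ _).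
- rewrite ler_peMr // big_seq; apply: prodr_ge0 => p /mem_belast pb.
  by apply: Pg; apply: (allP Ps2).
- by move=> p pb; apply: Pg; apply: (allP Ps2).
- apply: path_le2_uniq Ps2 us2 ss2 => p q /and4P [cp p0 _ tp] /and4P [cq q0 _ tq].
  move=> pq neq; apply: le_trans (closeness_gap cp cq p0 pq neq tp tq).
  rewrite ler_wpM2r ?ler0z ?(ltW p0) // /g.
  by move: tp; clear; lra.
Qed.

Lemma small_count r (L : 'I_r -> R[i] * R[i]) (m h Y : R) s :
    (forall i, (L i).1 != 0) ->
    (forall i p, p != (0, 0) -> lf (L i) p != 0) ->
    (forall u v, det2 u v = 1 -> m <= height (fun i => lsubst (L i) u v)) ->
    0 < h -> 1 <= m / (3 ^+ r * h) -> uniq s -> 1 <= Y ->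
    (forall p, p \in s -> [/\ coprimez p.1 p.2, 0 < p.2, p.2%:~R <= Y &
      nc (\prod_i lf (L i) p) <= h]) ->
  (m / (3 ^+ r * h)) ^+ (size s - r) <= Y ^+ r.
Proof.
move=> L1 Lp minm h0 m1 us Y1 hs.
have {hs}hs p : p \in s -> [/\ coprimez p.1 p.2, 0 < p.2, p.2%:~R <= Y &
    m / (3 ^+ r * h) <= \prod_i ((1 + closeness (L i) p) / 3)].
  move=> /hs [cp p0 pY ph]; split => //.
  have pn0 : p != (0, 0) by apply: contraTneq p0 => ->.
  have := height_le_closeness L1 (fun i => Lp i p pn0) minm cp p0 ph.
  rewrite big_split /= prodr_const card_ord exprVn ler_pdivrMr ?mulr_gt0 ?exprn_gt0 //.
  move=> H; apply: le_trans H _; rewrite mulrC le_eqVlt; apply/orP; left; apply/eqP.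
  have h3 : (3 : R) ^+ r != 0 by rewrite expf_neq0 // pnatr_eq0.
  by field.
have z_ex i : exists z, \prod_(p <- s | (2 <= closeness (L i) p) && (p != z))
    ((1 + closeness (L i) p) / 3) <= Y.
  by apply: small_chain => // p /hs [].
have [z zE] := boolp.choice z_ex.
pose Z := [seq z i | i <- enum 'I_r].
set s' := filter (fun p => p \notin Z) s.
have sZ : (size s - r <= size s')%N.
  rewrite leq_subLR -(count_predC (fun p => p \in Z)) -!size_filter leq_add //.
  have -> : r = size Z by rewrite size_map size_enum_ord.
  by apply: uniq_leq_size; [rewrite filter_uniq|move=> p; rewrite mem_filter => /andP[]].
apply: le_trans (ler_weXn2l m1 sZ) _.
have c0 i p : p \in s -> 0 <= closeness (L i) p.
  by case/hs => _ p0 _ _; rewrite invr_ge0 mulr_ge0 ?nc_ge0 // ler0z ltW.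
apply: le_trans (_ : \prod_(p <- s') \prod_i ((1 + closeness (L i) p) / 3) <= _).
  have : {subset s' <= s} by move=> p; rewrite mem_filter => /andP [].
  elim: s' {sZ} => [|p s' IH] sub; first by rewrite big_nil.
  rewrite big_cons exprS ler_pM ?exprn_ge0 ?(le_trans _ m1) //.
    by have [] := hs p (sub p (mem_head _ _)).
  by apply: IH => q qs; apply: sub; rewrite inE qs orbT.
rewrite exchange_big /= -[Y ^+ r](_ : \prod_(i < r) Y = _); last first.
  by rewrite prodr_const card_ord.
apply: ler_prod => i _; apply/andP; split.
  rewrite big_seq; apply: prodr_ge0 => p; rewrite mem_filter => /andP [_ ps].
  by rewrite divr_ge0 // addr_ge0 ?c0.
apply: le_trans (zE i); rewrite big_filter big_mkcond [X in _ <= X]big_mkcond /=.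
rewrite big_seq [X in _ <= X]big_seq; apply: ler_prod => p ps.
have t0 := c0 i p ps.
case: ifP => [pZ|_]; case: ifP => [/andP [t2 _]|].
- by rewrite lexx andbT; move: t0; clear; lra.
- have -> : p != z i.
    by apply: contraNneq pZ => ->; apply: map_f; rewrite mem_enum.
  rewrite andbT => /negbT; rewrite -ltNge; move: t0; clear => t0 t2.
  by apply/andP; split; lra.
- by rewrite ler01 /=; move: t2; clear; lra.
- by rewrite ler01 lexx.
Qed.

End SmallCount.

(** * Discriminant and change of basis *)

Section PairProducts.
Variables (S : Type) (idx : S) (op : Monoid.com_law idx) (r : nat).
Local Notation "x ** y" := (op x y) (at level 40).

(** Stated for a commutative monoid, as it is used additively to count the pairs and
    multiplicatively for heights and leading coefficients. *)
Lemma big_pairs_sym (m : 'I_r -> S) :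
  \big[op/idx]_(i < r) \big[op/idx]_(j < r | (i < j)%N) (m i ** m j) =
  \big[op/idx]_(i < r) \big[op/idx]_(j < r | j != i) m i.
Proof.
under eq_bigr do rewrite big_split.
rewrite big_split /= [X in _ ** X](exchange_big_dep predT) //= -big_split.
apply: eq_bigr => i _; rewrite [RHS](bigID (fun j : 'I_r => (i < j)%N)) /=.
congr (_ ** _); apply: eq_bigl => j; rewrite -val_eqE /=; case: ltngtP => //.
Qed.

Lemma big_pairs_split (d : 'I_r -> 'I_r -> S) (i : 'I_r) :
    (forall a b, d a b = d b a) ->
  \big[op/idx]_(a < r) \big[op/idx]_(b < r | (a < b)%N) d a b =
  (\big[op/idx]_(j < r | j != i) d i j) **
  (\big[op/idx]_(a < r | a != i) \big[op/idx]_(b < r | (a < b)%N && (b != i)) d a b).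
Proof.
move=> dC; rewrite (bigD1 i) //=.
have -> : \big[op/idx]_(a < r | a != i) \big[op/idx]_(b < r | (a < b)%N) d a b =
    (\big[op/idx]_(a < r | a != i) (if (a < i)%N then d i a else idx)) **
    \big[op/idx]_(a < r | a != i) \big[op/idx]_(b < r | (a < b)%N && (b != i)) d a b.
  rewrite -big_split; apply: eq_bigr => a ai; case: ifP => ai'.
    by rewrite (bigD1 i) //= dC.
  rewrite Monoid.mul1m; apply: eq_bigl => b; case: eqVneq => [->|];
    rewrite ?andbT ?andbF //.
rewrite Monoid.mulmA; congr (_ ** _).
rewrite -big_mkcondr /= [RHS](bigID (fun j : 'I_r => (i < j)%N)) /=.
congr (_ ** _); apply: eq_bigl => j; rewrite -val_eqE /=; case: ltngtP => //.
Qed.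

End PairProducts.

Definition npairs (r : nat) : nat := \sum_(i < r) \sum_(j < r | (i < j)%N) 1.

Lemma npairsE r : (npairs r * 2 = r * r.-1)%N.
Proof.
transitivity (\sum_(i < r) \sum_(j < r | (i < j)%N) (1 + 1))%N.
  by rewrite big_distrl; apply: eq_bigr => i _; rewrite big_distrl.
rewrite (@big_pairs_sym nat 0%N addn r (fun=> 1%N)).
under eq_bigr => i _ do rewrite sum1_card (eq_card (B := predC1 i)) ?cardC1 ?card_ord //.
by rewrite sum_nat_const card_ord.
Qed.

Lemma prod_pairs_const (K : comNzSemiRingType) (r : nat) (c : K) :
  \prod_(i < r) \prod_(j < r | (i < j)%N) c = c ^+ npairs r.
Proof.
rewrite /npairs expr_sum; apply: eq_bigr => i _.
by rewrite prodr_const sum1_card.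
Qed.

Section Disc.
Variable R : realType.
Implicit Types (l : R[i] * R[i]) (p q u v : int * int).

Definition ldet l l' : R[i] := l.1 * l'.2 - l.2 * l'.1.

(* The square root of |D(F)|, for F the product of the L i. *)
Definition disc1 r (L : 'I_r -> R[i] * R[i]) : R :=
  \prod_(i < r) \prod_(j < r | (i < j)%N) nc (ldet (L i) (L j)).

Lemma disc1_subst r (L : 'I_r -> R[i] * R[i]) u v :
  disc1 (fun i => lsubst (L i) u v) = disc1 L * `|det2 u v|%:~R ^+ npairs r.
Proof.
rewrite /disc1 -prod_pairs_const -big_split; apply: eq_bigr => i _.
rewrite -big_split; apply: eq_bigr => j _.
rewrite /= -nc_int -ncM; congr nc.
by rewrite /ldet /lsubst /lf /det2 rmorphB !rmorphM /=; ring.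
Qed.

Definition lmax l : R := Num.max (nc l.1) (nc l.2).

Lemma nc_ldet_le l l' : nc (ldet l l') <= 2 * (lmax l * lmax l').
Proof.
apply: le_trans (ncB _ _) _; rewrite !ncM mulr_natl mulr2n.
by apply: lerD; apply: ler_pM; rewrite ?nc_ge0 // le_max lexx ?orbT.
Qed.

Lemma lmax_ge0 l : 0 <= lmax l.
Proof. by rewrite le_max nc_ge0. Qed.

Lemma prod_pairs_lmax r (L : 'I_r -> R[i] * R[i]) :
  \prod_(i < r) \prod_(j < r | (i < j)%N) (2 * (lmax (L i) * lmax (L j))) =
  2 ^+ npairs r * height L ^+ r.-1.
Proof.
under eq_bigr do rewrite big_split /=.
rewrite big_split /= prod_pairs_const; congr (_ * _).
rewrite (@big_pairs_sym R 1 *%R r (fun i => lmax (L i))) /height -prodrXl;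
  apply: eq_bigr => i _.
rewrite prodr_const; congr (_ ^+ _).
by rewrite -[r in RHS]card_ord -(cardC1 i); apply: eq_card => j; rewrite !inE.
Qed.

Lemma disc1_le r (L : 'I_r -> R[i] * R[i]) :
  disc1 L <= 2 ^+ npairs r * height L ^+ r.-1.
Proof.
rewrite -prod_pairs_lmax; apply: ler_prod => i _.
rewrite prodr_ge0 => [|j _]; last exact: nc_ge0.
by apply: ler_prod => j _; rewrite nc_ge0 nc_ldet_le.
Qed.

(** Only the pairs avoiding i are estimated trivially; the pairs containing i are kept. With a lower
    bound on [disc1 L] this bounds from below the product of the determinants of L i with the other
    forms, as needed in [near_root]. *)
Lemma disc1_le_root r (L : 'I_r -> R[i] * R[i]) (i : 'I_r) :
  disc1 L * \prod_(j < r | j != i) (2 * (lmax (L i) * lmax (L j))) <=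
  (\prod_(j < r | j != i) nc (ldet (L i) (L j)))
    * (2 ^+ npairs r * height L ^+ r.-1).
Proof.
rewrite -prod_pairs_lmax /disc1.
rewrite (@big_pairs_split _ _ *%R r (fun a b => nc (ldet (L a) (L b))) i); last first.
  by move=> a b; rewrite -ncN; congr nc; rewrite /ldet; ring.
rewrite (@big_pairs_split _ _ *%R r (fun a b => 2 * (lmax (L a) * lmax (L b))) i);
  last by move=> a b; ring.
rewrite -mulrA; apply: ler_wpM2l; first by rewrite prodr_ge0 // => j _; exact: nc_ge0.
rewrite mulrC; apply: ler_wpM2l.
  by rewrite prodr_ge0 // => j _; rewrite !mulr_ge0 // lmax_ge0.
apply: ler_prod => a _; rewrite prodr_ge0 => [|j _]; last exact: nc_ge0.
by apply: ler_prod => j _; rewrite nc_ge0 nc_ldet_le.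
Qed.

End Disc.

(** The target ring S is general for two uses: the values at integer points (phi the identity) and
    the substitution of linear polynomials (phi = [polyC]). *)
Lemma prod_linear_hom (K S : comNzRingType) (phi : {rmorphism K -> S})
    (s : seq (K * K)) (P Q : S) :
  \prod_(l <- s) (phi l.1 * P + phi l.2 * Q) =
  \sum_(k < (size s).+1) phi (\prod_(l <- s) (l.1 *: 'X + l.2%:P))`_k
    * (P ^+ k * Q ^+ (size s - k)).
Proof.
elim: s => [|[a b] s IH].
  by rewrite !big_nil big_ord1 coef1 rmorph1 !expr0 !mulr1.
rewrite big_cons IH /=; set n := size s.
rewrite [in RHS]big_cons /=; set p := \prod_(l <- s) _.
have sp : (size p <= n.+1)%N.
  rewrite /p /n; elim: (s) => [|l t IHt]; first by rewrite big_nil size_poly1.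
  rewrite big_cons; apply: leq_trans (size_polyMleq _ _) _.
  have sl : (size (l.1 *: 'X + l.2%:P)%R <= 2)%N.
    rewrite (leq_trans (size_polyD _ _)) // geq_max (leq_trans (size_scale_leq _ _)).
      by rewrite (leq_trans (size_polyC_leq1 _)).
    by rewrite size_polyX.
  by rewrite -subn1 leq_subLR (leq_trans (leq_add sl IHt)).
transitivity (\sum_(k < n.+2) (phi a * phi (p * 'X)`_k + phi b * phi p`_k)
    * (P ^+ k * Q ^+ (n.+1 - k))); last first.
  apply: eq_bigr => k _; congr (_ * _); rewrite mulrDl coefD coefCM rmorphD.
  by rewrite -scalerAl coefZ !rmorphM /= commr_polyX.
under [RHS]eq_bigr do rewrite mulrDl.
rewrite big_split /= mulrDl; congr (_ + _).
  rewrite [RHS]big_ord_recl coefMX /= rmorph0 mulr0 mul0r add0r mulr_sumr.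
  by apply: eq_bigr => k _; rewrite coefMX /= subSS exprS; ring.
rewrite [RHS]big_ord_recr /= [p`__]nth_default // rmorph0 mulr0 mul0r addr0 mulr_sumr.
by apply: eq_bigr => k _; rewrite subSn ?exprS -1?ltnS //; ring.
Qed.

(** * Integral forms under integral substitutions *)

Section ThueForm.
Variable R : realType.
Implicit Types (l : R[i] * R[i]) (p q u v : int * int).

(** What is retained of an irreducible form: integral coefficients and roots of degree at least r.
    These properties survive every integral substitution of nonzero determinant, hence the passage
    to sublattices and to reduced bases. *)
Definition thue_form r (L : 'I_r -> R[i] * R[i]) : Prop :=
  (exists f : {poly int},
    map_poly intr f = \prod_i ((L i).1 *: 'X + (L i).2%:P)) /\
  (forall i, (L i).1 != 0 /\ algdeg r (lroot (L i))).

Lemma prod_linear_hom_ord (K S : comNzRingType) (phi : {rmorphism K -> S}) r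
    (L : 'I_r -> K * K) (P Q : S) :
  \prod_i (phi (L i).1 * P + phi (L i).2 * Q) =
  \sum_(k < r.+1) phi (\prod_i ((L i).1 *: 'X + (L i).2%:P))`_k
    * (P ^+ k * Q ^+ (r - k)).
Proof.
have := prod_linear_hom phi [seq L i | i <- index_enum 'I_r] P Q.
have sz : size (index_enum 'I_r) = r by rewrite [index_enum _]unlock -enumT size_enum_ord.
by rewrite !big_map size_map sz.
Qed.

Lemma thue_form_value r (L : 'I_r -> R[i] * R[i]) p :
  thue_form L -> exists m : int, \prod_i lf (L i) p = m%:~R.
Proof.
move=> [[f fE] _]; rewrite /lf.
have := prod_linear_hom_ord (idfun : {rmorphism R[i] -> R[i]}) L p.1%:~R p.2%:~R.
rewrite /= => ->; rewrite -fE.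
exists (\sum_(k < r.+1) f`_k * (p.1 ^+ k * p.2 ^+ (r - k))).
by rewrite rmorph_sum; apply: eq_bigr => k _; rewrite coef_map !rmorphM !rmorphXn.
Qed.

Lemma algdeg_lf_neq0 r l p : (2 <= r)%N -> l.1 != 0 -> algdeg r (lroot l) ->
  p != (0, 0) -> lf l p != 0.
Proof.
move=> r2 l0 ldeg; apply: contraNneq; rewrite lf_root // => /eqP.
rewrite mulf_eq0 (negPf l0) /= subr_eq0 => /eqP e.
have [p2|p2] := eqVneq p.2 0.
  by move: e; rewrite p2 mulr0 => /eqP; rewrite intr_eq0 => /eqP p1;
    case: p p1 p2 => ? ? /= -> ->.
have := algdeg_neq r2 ldeg (p.1%:~R / p.2%:~R); rewrite (fmorph_div ratr) /= !ratr_int e.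
by rewrite mulfK ?intr_eq0 // eqxx.
Qed.

Lemma poly_nat_roots (P : {poly rat}) : (forall n : nat, P.[n%:R] = 0) -> P = 0.
Proof.
move=> h; apply/eqP; apply: contraT => P0.
have := @max_poly_roots _ P [seq n%:R | n <- iota 0 (size P)] P0.
rewrite size_map size_iota ltnn; apply.
  by apply/allP => x /mapP [n _ ->]; apply/eqP.
by rewrite map_inj_uniq ?iota_uniq // => a b /eqP; rewrite eqr_nat => /eqP.
Qed.

Lemma size_linear_pow (P Q : {poly rat}) (j k : nat) :
  (size P <= 2)%N -> (size Q <= 2)%N -> (size (P ^+ j * Q ^+ k)%R <= (j + k).+1)%N.
Proof.
have hX (T : {poly rat}) n : (size T <= 2)%N -> (size (T ^+ n) <= n.+1)%N.
  move=> sT; apply: leq_trans (size_poly_exp_leq _ _) _.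
  by rewrite ltnS -[X in (_ <= X)%N]mul1n leq_mul2r; case: (size T) sT => [|[|[|?]]];
    rewrite ?orbT.
move=> sP sQ; apply: leq_trans (size_polyMleq _ _) _.
by rewrite -subn1 leq_subLR (leq_trans (leq_add (hX _ j sP) (hX _ k sQ))) // addSn addnS.
Qed.

(** If G, of degree less than r, kills the image P(x)/Q(x), then Q^(r-1) G(P/Q) is a polynomial of
    degree less than r that kills x, hence is zero. Since P/Q is invertible, G vanishes at almost
    all integers. *)
Lemma algdeg_moebius r (x : R[i]) u v : (2 <= r)%N -> algdeg r x -> det2 u v != 0 ->
  algdeg r ((v.2%:~R * x - v.1%:~R) / (u.1%:~R - u.2%:~R * x)).
Proof.
move=> r2 xdeg duv G sG Gx.
pose P : {poly rat} := v.2%:~R *: 'X - (v.1%:~R)%:P.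
pose Q : {poly rat} := (u.1%:~R)%:P - u.2%:~R *: 'X.
pose Gh := \sum_(k < r) G`_k *: (P ^+ k * Q ^+ (r.-1 - k)).
have hom (K : numFieldType) (y : K) (phi := map_poly ratr : {poly rat} -> {poly K}) :
    (phi Q).[y] != 0 ->
    (phi Gh).[y] = (phi Q).[y] ^+ r.-1 * (phi G).[(phi P).[y] / (phi Q).[y]].
  move=> Q0; rewrite /phi /Gh rmorph_sum horner_sum.
  rewrite (horner_coef_wide (n := r) (p := map_poly ratr G)); last first.
    by rewrite (size_map_poly (ratr : {rmorphism rat -> K})).
  rewrite mulr_sumr; apply: eq_bigr => k _.
  rewrite -mul_polyC !rmorphM !rmorphXn /= map_polyC !hornerM hornerC !horner_exp
    coef_map /=.
  have {2}-> : r.-1 = (k + (r.-1 - k))%N.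
    by rewrite subnKC // -ltnS (leq_trans (ltn_ord k)) // leqSpred.
  rewrite exprD expr_div_n; have := expf_neq0 k Q0;
    move: ((_ : {poly K}).[y] ^+ k) => qk qk0.
  by field.
have Qx : (map_poly ratr Q).[x] = u.1%:~R - u.2%:~R * x.
  by rewrite rmorphB -mul_polyC rmorphM /= !map_polyC map_polyX !hornerE /= !ratr_int.
have Px : (map_poly ratr P).[x] = v.2%:~R * x - v.1%:~R.
  by rewrite rmorphB -mul_polyC rmorphM /= !map_polyC map_polyX !hornerE /= !ratr_int.
have Qx0 : (map_poly ratr Q).[x] != 0.
  rewrite Qx subr_eq0; have [u2|u2] := eqVneq u.2 0.
    rewrite u2 mul0r intr_eq0; apply: contraNneq duv => u1.
    by rewrite /det2 u1 u2 !mul0r subrr.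
  have := algdeg_neq r2 xdeg (u.1%:~R / u.2%:~R); rewrite (fmorph_div ratr) /= !ratr_int.
  by apply: contraNneq => ->; rewrite mulrAC divff ?mul1r // intr_eq0.
have Gh0 : Gh = 0.
  apply: xdeg; last by rewrite hom // Qx Px Gx mulr0.
  apply/(leq_trans (size_sum _ _ _))/bigmax_leqP => k _.
  apply: leq_trans (size_scale_leq _ _) _.
  apply: leq_trans (size_linear_pow _ _ _ _) _.
  - rewrite (leq_trans (size_polyD _ _)) // geq_max size_polyN.
    by rewrite (leq_trans (size_scale_leq _ _)) ?size_polyX // (leq_trans
      (size_polyC_leq1 _)).
  - rewrite (leq_trans (size_polyD _ _)) // geq_max size_polyN.
    by rewrite (leq_trans (size_polyC_leq1 _)) // (leq_trans (size_scale_leq _ _))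
      ?size_polyX.
  - by rewrite subnKC ?prednK // ?(ltnW r2) // -ltnS prednK // ltnW.
have vn0 : u.2%:~R *: 'X + (v.2%:~R)%:P != 0 :> {poly rat}.
  apply: contraNneq duv => h; have h1 := congr1 (fun P : {poly rat} => P`_1) h.
  have h0 := congr1 (fun P : {poly rat} => P`_0) h.
  move: h0 h1; rewrite !coef0 !coefD !coefZ !coefX !coefC /= mulr0 mulr1 add0r addr0.
  move=> /eqP; rewrite intr_eq0 => /eqP v2 /eqP; rewrite intr_eq0 => /eqP u2.
  by rewrite /det2 v2 u2 mulr0 mul0r subrr.
suff : G * (u.2%:~R *: 'X + (v.2%:~R)%:P) = 0.
  by move/eqP; rewrite mulf_eq0 (negPf vn0) orbF => /eqP.
apply: poly_nat_roots => n; pose d : rat := u.2%:~R * n%:R + v.2%:~R.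
have dE : (u.2%:~R *: 'X + (v.2%:~R)%:P).[n%:R] = d by rewrite !hornerE.
apply/eqP; rewrite hornerM mulf_eq0 dE.
have [_|d0] := eqVneq d 0; first by rewrite orbT.
rewrite orbF.
have det0 : u.1%:~R * v.2%:~R - u.2%:~R * v.1%:~R != 0 :> rat.
  by rewrite -!rmorphM -rmorphB intr_eq0.
(* The preimage of n under P/Q. It does not exist when d = 0, which is why G was multiplied by u.2 X
   + v.2. *)
pose y : rat := (u.1%:~R * n%:R + v.1%:~R) / d.
have idE (T : {poly rat}) : map_poly ratr T = T.
  by apply: map_poly_id => z _;
    rewrite /= -(fmorph_eq_rat (idfun : {rmorphism rat -> rat})).
have Qy : Q.[y] = (u.1%:~R * v.2%:~R - u.2%:~R * v.1%:~R) / d.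
  by move: d0; rewrite /Q hornerD hornerN hornerZ hornerX hornerC /y /d => d0'; field.
have Py : P.[y] = n%:R * Q.[y].
  by move: d0; rewrite Qy /P hornerD hornerN hornerZ hornerX hornerC /y /d => d0'; field.
have Qy0 : Q.[y] != 0 by rewrite Qy mulf_neq0 ?invr_eq0.
have := hom rat y; rewrite /= !idE Gh0 horner0 Py mulfK // => /(_ Qy0)/esym/eqP.
by rewrite mulf_eq0 expf_eq0 (negPf Qy0) andbF /= => ->.
Qed.

Lemma thue_form_subst r (L : 'I_r -> R[i] * R[i]) u v : (2 <= r)%N ->
  det2 u v != 0 -> thue_form L -> thue_form (fun i => lsubst (L i) u v).
Proof.
move=> r2 duv [[f fE] Ldeg].
have un0 : u != (0, 0).
  by apply: contraNneq duv => ->; rewrite /det2 !mul0r subrr.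
split.
  exists (\sum_(k < r.+1) (f`_k)%:P * ((u.1%:P * 'X + v.1%:P) ^+ k
    * (u.2%:P * 'X + v.2%:P) ^+ (r - k))).
  transitivity (\prod_i (((L i).1)%:P * ((u.1%:~R)%:P * 'X + (v.1%:~R)%:P)
      + ((L i).2)%:P * ((u.2%:~R)%:P * 'X + (v.2%:~R)%:P)) : {poly R[i]}); last first.
    apply: eq_bigr => i _; rewrite /lsubst /lf /= -mul_polyC !polyCD !polyCM; ring.
  rewrite (prod_linear_hom_ord polyC) -fE rmorph_sum; apply: eq_bigr => k _.
  by rewrite coef_map !rmorphM !rmorphXn !rmorphD !rmorphM /= !map_polyC map_polyX.
move=> i; have [l0 ldeg] := Ldeg i; split.
  exact: algdeg_lf_neq0 r2 l0 ldeg un0.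
have := algdeg_moebius r2 ldeg duv; congr algdeg.
rewrite /lroot /lsubst /=; set x := - _ / _.
rewrite !lf_root //; rewrite -/x -[x]/(lroot (L i)).
have h : u.1%:~R - lroot (L i) * u.2%:~R != 0.
  have := algdeg_lf_neq0 r2 l0 ldeg un0; rewrite lf_root // mulf_eq0 negb_or.
  by case/andP.
field; exact/andP.
Qed.

End ThueForm.

(** * Large solutions *)

Section LargeSolutions.
Variables (R : realType) (r : nat) (L : 'I_r -> R[i] * R[i]).
Hypotheses (r3 : (3 <= r)%N) (Lform : thue_form L).
Implicit Types (p q : int * int).
Local Notation M := (height L).

Let r2 : (2 <= r)%N. Proof. exact: ltnW. Qed.
Let L1 i : (L i).1 != 0. Proof. by case: (Lform.2 i). Qed.
Let Ldeg i : algdeg r (lroot (L i)). Proof. by case: (Lform.2 i). Qed.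

Lemma thue_form_lf_neq0 i p : p != (0, 0) -> lf (L i) p != 0.
Proof. exact: algdeg_lf_neq0 r2 (L1 i) (@Ldeg i). Qed.

Lemma lmax_gt0 i : 0 < lmax (L i).
Proof. by rewrite lt_max nc_gt0 L1. Qed.

Lemma height_gt0 : 0 < M.
Proof. by apply: prodr_gt0 => i _; apply: lmax_gt0. Qed.

(** The leading coefficient of the form is a nonzero integer, so the product of the |L_j.1| is at
    least 1 and compensates the denominator of the root. *)
Lemma nc_lroot_le i : nc (lroot (L i)) <= M.
Proof.
have [m mE] := thue_form_value (1, 0) Lform.
have m1 : 1 <= nc (\prod_j (L j).1).
  have -> : \prod_j (L j).1 = m%:~R.
    by rewrite -mE; apply: eq_bigr => j _; rewrite /lf /= mulr0 mulr1 addr0.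
  apply: nc_int_ge1; apply/eqP => m0; move: mE; rewrite m0 => /eqP.
  by rewrite prodf_seq_eq0 => /hasP [j _ /=]; rewrite (negPf (thue_form_lf_neq0 j _)).
have a0 : 0 < nc (L i).1 by rewrite nc_gt0.
rewrite /lroot ncM ncV ncN ler_pdivrMr //.
apply: le_trans (_ : lmax (L i) <= _); first by rewrite le_max lexx orbT.
rewrite /height (bigD1 i) //= -mulrA ler_peMr ?lmax_ge0 //.
apply: le_trans m1 _; rewrite (bigD1 i) //= ncM mulrC ler_wpM2r ?nc_ge0 // nc_prod.
by apply: ler_prod => j _; rewrite nc_ge0 le_max lexx.
Qed.

Lemma nc_coef_prod_le (s : seq (R[i] * R[i])) (k : nat) :
  nc (\prod_(l <- s) (l.1 *: 'X + l.2%:P))`_k <= \prod_(l <- s) (nc l.1 + nc l.2).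
Proof.
elim: s k => [|l s IH] k.
  by rewrite !big_nil coef1; case: k => [|k]; rewrite ?nc1 // nc0.
rewrite !big_cons mulrDl coefD coefCM -scalerAl coefZ coefXM.
apply: le_trans (ncD _ _) _; rewrite !ncM mulrDl lerD // ler_wpM2l ?nc_ge0 ?IH //.
case: eqP => _; last exact: IH.
by rewrite nc0 prodr_ge0 // => j _; rewrite addr_ge0 ?nc_ge0.
Qed.

Lemma thue_form_poly : exists f : {poly int},
  [/\ size f = r.+1, forall i, (map_poly intr f).[lroot (L i)] = 0 :> R[i] &
      forall k, `|f`_k|%:~R <= 2 ^+ r * M].
Proof.
have [[f fE] _] := Lform; exists f.
have sz : size f = size (map_poly intr f : {poly R[i]}).
  by rewrite size_map_inj_poly //; apply: intr_inj.
have lin i : (L i).1 *: 'X + (L i).2%:P = (L i).1 *: ('X - (lroot (L i))%:P).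
  by rewrite scalerBr scale_polyC /lroot mulrCA divff ?L1 // mulr1 polyCN opprK.
split.
- rewrite sz fE size_prod => [|i _]; last first.
    by rewrite lin scaler_eq0 negb_or L1 polyXsubC_eq0.
  under eq_bigr do rewrite lin size_scale ?L1 // size_XsubC.
  by rewrite sum_nat_const card_ord; lia.
- move=> i; rewrite fE horner_prod (bigD1 i) //= lin hornerZ hornerXsubC subrr.
  by rewrite mulr0 mul0r.
- move=> k; rewrite -nc_int -coef_map fE.
  have := nc_coef_prod_le [seq L i | i <- index_enum 'I_r] k; rewrite !big_map.
  move/le_trans; apply; rewrite -[r in 2 ^+ r]card_ord -prodr_const -big_split.
  apply: ler_prod => i _; rewrite addr_ge0 ?nc_ge0 //= mulr_natl mulr2n.
  by rewrite lerD // le_max lexx ?orbT.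
Qed.

(** Take i with x - alpha_i y smallest. For j different from i, y |ldet(L_i, L_j)| <= 2 |L_i.1|
    |L_j(p)| by the triangle inequality, and [disc1_le_root] bounds the product of these
    determinants from below. So the other forms are not small at p, and |L_i(p)| must be. *)
Lemma near_root (h : R) p :
    1 <= h -> h <= M -> 2 ^+ npairs r <= disc1 L -> 0 < p.2 ->
    nc (\prod_i lf (L i) p) <= h ->
  exists i, nc (p.1%:~R - lroot (L i) * p.2%:~R) * p.2%:~R ^+ r.-1 <= M ^+ r.-1.
Proof.
move=> h1 hM hD p0 ph.
have [|i _ imin] := @arg_minP _ R 'I_r (Ordinal (ltnW (ltnW r3))) xpredT
  (fun i => nc (p.1%:~R - lroot (L i) * p.2%:~R)); first by [].
exists i; set y : R := p.2%:~R; have y0 : 0 < y by rewrite ltr0z.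
set a := nc (L i).1; have a0 : 0 < a by rewrite nc_gt0.
set m := lmax (L i); have m0 : 0 < m by apply: lmax_gt0.
have M0 := height_gt0.
set e := nc (p.1%:~R - lroot (L i) * p.2%:~R).
have Le : nc (lf (L i) p) = a * e by rewrite lf_root // ncM.
have step1 : y ^+ r.-1 * \prod_(j | j != i) nc (ldet (L i) (L j)) <=
    (2 * a) ^+ r.-1 * \prod_(j | j != i) nc (lf (L j) p).
  have cI (c : R) : c ^+ r.-1 = \prod_(j < r | j != i) c.
    by rewrite prodr_const -[r in LHS]card_ord -(cardC1 i); congr (_ ^+ _);
      apply: eq_card => j; rewrite !inE.
  rewrite !cI -!big_split /=; apply: ler_prod => j ji.
  rewrite mulr_ge0 ?nc_ge0 ?(ltW y0) //=.
  have -> : y * nc (ldet (L i) (L j)) = a * (nc (L j).1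
      * nc ((p.1%:~R - lroot (L j) * p.2%:~R) - (p.1%:~R - lroot (L i) * p.2%:~R))).
    have -> : y = nc (p.2%:~R : R[i]) by rewrite nc_int gtr0_norm.
    rewrite /a -!ncM; congr nc; rewrite /ldet /lroot.
    by have := L1 i; have := L1 j => l2 l1; field; exact/andP.
  rewrite lf_root // ncM -[2 * a * _]mulrA [X in _ <= X]mulrCA ler_pM2l // [X in _ <=
    X]mulrCA.
  rewrite ler_wpM2l ?nc_ge0 //.
  apply: le_trans (ncB _ _) _; rewrite mulr_natl mulr2n lerD2l.
  exact: imin.
have step2 : \prod_(j | j != i) (2 * (m * lmax (L j))) <=
    \prod_(j | j != i) nc (ldet (L i) (L j)) * M ^+ r.-1.
  have P2 : 0 < (2 : R) ^+ npairs r by rewrite exprn_gt0.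
  rewrite -(ler_pM2l P2); apply: le_trans (le_trans (_ : _ <= _) (disc1_le_root L i)) _.
    rewrite ler_wpM2r // prodr_ge0 // => j _.
    by rewrite !mulr_ge0 ?lmax_ge0.
  by rewrite mulrCA.
have step3 : m * \prod_(j | j != i) (2 * (m * lmax (L j))) = (2 * m) ^+ r.-1 * M.
  rewrite /height [in RHS](bigD1 i) //= mulrCA; congr (_ * _).
  under eq_bigr do rewrite mulrA.
  rewrite big_split /= prodr_const; congr (_ ^+ _ * _).
  by rewrite -[r in RHS]card_ord -(cardC1 i); apply: eq_card => j; rewrite !inE.
have step4 : a * e * \prod_(j | j != i) nc (lf (L j) p) <= M.
  apply: le_trans hM; apply: le_trans ph; rewrite nc_prod [X in _ <= X](bigD1 i) //=.
  by rewrite Le.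
set P := \prod_(j | j != i) nc (ldet (L i) (L j)) in step1 step2.
set Q := \prod_(j | j != i) nc (lf (L j) p) in step1 step4.
rewrite mulrC.
have e0 : 0 <= e by rewrite nc_ge0.
have : m * m ^+ r.-2 * M * a * (y ^+ r.-1 * e) <= m * m ^+ r.-2 * M * a * M ^+ r.-1.
  have rE : r.-1 = r.-2.+1 by case: (r) r3 => [|[|]].
  have step5 : m ^+ r.-1 * M * y ^+ r.-1 <= a ^+ r.-1 * m * M ^+ r.-1 * Q.
    have c2 : 0 < (2 : R) ^+ r.-1 by rewrite exprn_gt0.
    rewrite -(ler_pM2l c2) !mulrA -exprMn -step3.
    have : m * y ^+ r.-1 * \prod_(j | j != i) (2 * (m * lmax (L j))) <=
       m * y ^+ r.-1 * (P * M ^+ r.-1).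
      by rewrite ler_wpM2l // mulr_ge0 ?exprn_ge0 // ltW.
    rewrite mulrAC => /le_trans; apply.
    have : m * M ^+ r.-1 * (y ^+ r.-1 * P) <= m * M ^+ r.-1 * ((2 * a) ^+ r.-1 * Q).
      by rewrite ler_wpM2l // mulr_ge0 ?exprn_ge0 // ltW.
    by rewrite exprMn; congr (_ <= _); ring.
  have Me : a ^+ r.-1 * m * M ^+ r.-1 * Q * (a * e) <= a ^+ r.-1 * m * M ^+ r.-1 * M.
    rewrite -[X in X <= _]mulrA [Q * _]mulrC ler_wpM2l //.
    by rewrite !mulr_ge0 ?exprn_ge0 // ltW.
  have : m ^+ r.-1 * M * y ^+ r.-1 * (a * e) <= a ^+ r.-1 * m * M ^+ r.-1 * M.
    by apply: le_trans (ler_wpM2r _ step5) Me; rewrite mulr_ge0 // ltW.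
  have am : a ^+ r.-2 <= m ^+ r.-2.
    by rewrite lerXn2r ?nnegrE ?(ltW a0) ?(ltW m0) // le_max lexx.
  have ex (c : R) : c ^+ r.-1 = c * c ^+ r.-2 by rewrite {1}rE exprS.
  rewrite (ex m) (ex a) => H.
  have K0 : 0 <= a * m * M ^+ r.-1 * M.
    by rewrite !mulr_ge0 ?exprn_ge0 // ltW.
  have {}am := ler_wpM2l K0 am.
  apply: le_trans (le_trans (_ : _ <= m * m ^+ r.-2 * M * y ^+ r.-1 * (a * e)) H) _.
    by rewrite le_eqVlt; apply/orP; left; apply/eqP; ring.
  apply: le_trans (le_trans (_ : _ <= a * m * M ^+ r.-1 * M * a ^+ r.-2) am) _.
    by rewrite le_eqVlt; apply/orP; left; apply/eqP; ring.
  by rewrite le_eqVlt; apply/orP; left; apply/eqP; ring.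
rewrite ler_pM2l //; do !apply: mulr_gt0 => //; exact: exprn_gt0.
Qed.

End LargeSolutions.

Section LargeCount.
Variables (R : realType) (r : nat) (L : 'I_r -> R[i] * R[i]).
Hypotheses (r3 : (3 <= r)%N) (Lform : thue_form L).
Local Notation M := (height L).
Hypothesis hM : 2 ^+ (20 * r) <= M.
Implicit Types (p q : int * int) (s : seq (int * int)).

Definition large_near (l : R[i] * R[i]) p : bool :=
  [&& coprimez p.1 p.2, 0 < p.2, M ^+ 4 <= p.2%:~R &
    nc (p.1%:~R - lroot l * p.2%:~R) * p.2%:~R ^+ r.-1 <= M ^+ r.-1].

Lemma height_ge2 : 2 <= M.
Proof.
have r1 : (0 < 20 * r)%N by rewrite muln_gt0; case: (r) r3.
apply: le_trans hM; rewrite -(prednK r1) exprS ler_peMr // exprn_ege1 //.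
by rewrite ler1n.
Qed.

Lemma large_near_closeness i p : large_near (L i) p ->
  p.2%:~R ^+ r.-2 / M ^+ r.-1 <= closeness (L i) p.
Proof.
case/and4P => cp p0 pM; set y : R := p.2%:~R; set e := nc _ => pe.
have y0 : 0 < y by rewrite ltr0z.
have M0 : 0 < M by apply: lt_le_trans height_ge2.
have e0 : 0 < e.
  have pn : p != (0, 0) by apply: contraTneq p0 => ->.
  have := thue_form_lf_neq0 r3 Lform i pn; rewrite lf_root; last by case: (Lform.2 i).
  by rewrite mulf_eq0 negb_or nc_gt0 => /andP [].
have rE : r.-1 = r.-2.+1 by case: (r) r3 => [|[|]].
rewrite /closeness -/y -/e -[(y * e)^-1]mul1r ler_pdivrMr ?exprn_gt0 //.
rewrite mul1r [(y * e)^-1 * _]mulrC ler_pdivlMr ?mulr_gt0 //.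
by apply: le_trans pe; rewrite [in X in _ <= X]rE exprS; rewrite le_eqVlt; apply/orP;
  left; apply/eqP; ring.
Qed.

(** The gap reads q.2 >= p.2^(r-1) / M^r, its factor 1/2 being absorbed by M >= 2. This affine
    recursion for the logarithms has fixed point r/(r - 2) ln M <= 3 ln M, so the shift by 3 ln M
    makes the growth geometric; the threshold M^4 puts the first shifted term at ln M or more. *)
Lemma large_gap i p q : large_near (L i) p -> large_near (L i) q -> le2 p q -> p != q ->
  (r%:R - 1) * (ln (p.2%:~R : R) - 3 * ln M) <= ln (q.2%:~R : R) - 3 * ln M.
Proof.
move=> hp hq pq neq.
have tp := large_near_closeness hp; have tq := large_near_closeness hq.
case/and4P: hp => cp p0 pM _; case/and4P: hq => cq q0 qM _.
have M2 := height_ge2; have M1 : 1 <= M by apply: le_trans M2; rewrite ler1n.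
have M0 : 0 < M by apply: lt_le_trans M2.
have big (y : R) : M ^+ 4 <= y -> 2 <= y ^+ r.-2 / M ^+ r.-1.
  move=> yM; rewrite ler_pdivlMr ?exprn_gt0 //.
  apply: le_trans (ler_wpM2r _ M2) _; first by rewrite exprn_ge0 // ltW.
  rewrite -exprS; apply: le_trans (_ : (M ^+ 4) ^+ r.-2 <= _).
    rewrite -exprM ler_weXn2l //; case: (r) r3 => [|[|n]] //= n3.
    by move: n3; clear; lia.
  by rewrite lerXn2r ?nnegrE ?exprn_ge0 ?(ltW M0) // (le_trans _ yM) ?exprn_ge0 // ltW.
have := closeness_gap cp cq p0 pq neq (le_trans (big _ pM) tp) (le_trans (big _ qM) tq).
set y : R := p.2%:~R in tp pM *; set z : R := q.2%:~R in tq qM *.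
have y0 : 0 < y by rewrite ltr0z.
have z0 : 0 < z by rewrite ltr0z.
move=> hz; have {}hz : y ^+ r.-1 / M ^+ r <= z.
  apply: le_trans hz; apply: le_trans (_ : y ^+ r.-2 / M ^+ r.-1 / 2 * y <= _).
    have -> : y ^+ r.-2 / M ^+ r.-1 / 2 * y = y ^+ r.-1 / (2 * M ^+ r.-1).
      have ex (c : R) : c ^+ r.-1 = c * c ^+ r.-2.
        by rewrite -exprS; case: (r) r3 => [|[|]].
      have M0' := lt0r_neq0 M0; have := expf_neq0 r.-2 M0'.
      by rewrite !ex => Mr; field; rewrite Mr.
    rewrite ler_wpM2l ?exprn_ge0 ?(ltW y0) // lef_pV2 ?posrE ?mulr_gt0 ?exprn_gt0 //.
    have -> : M ^+ r = M * M ^+ r.-1 by rewrite -exprS prednK //; case: (r) r3.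
    by rewrite ler_wpM2r ?exprn_ge0 // ltW.
  apply: ler_wpM2r; first exact: ltW.
  by apply: ler_wpM2r => //; rewrite invr_ge0.
have : ln (y ^+ r.-1 / M ^+ r) <= ln z by rewrite ler_ln ?posrE ?divr_gt0 ?exprn_gt0.
rewrite ln_div ?posrE ?exprn_gt0 // !lnXn // -[_ *+ r]mulr_natl -[_ *+ r.-1]mulr_natl.
have -> : r.-1%:R = r%:R - 1 :> R.
  by rewrite -subn1 natrB //; case: (r) r3.
have r3R : 3 <= r%:R :> R by rewrite ler_nat.
have s0 : 0 <= ln M by rewrite ln_ge0.
have : 3 * ln M <= r%:R * ln M by rewrite ler_wpM2r.
rewrite mulrBr mulrBl mul1r mulrBl mul1r.
have -> : r%:R * (3 * ln M) = 3 * (r%:R * ln M) by ring.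
by move: (r%:R * ln y) (r%:R * ln M) (ln M) s0 => a b c; clear; lra.
Qed.

(** The origin of 22 = 14 + 8: after 14 gaps Thue's method may start, and after 8 more the second
    solution is far enough from the first. The worst ratio is r - 1 = 2. *)
Lemma large_steps : (1000 * (r * r) <= r.-1 ^ 14)%N /\ (66 * r <= r.-1 ^ 8)%N.
Proof.
have r2 : (2 <= r.-1)%N by case: (r) r3 => [|[|[|]]].
have e12 : (4096 <= r.-1 ^ 12)%N by rewrite -[4096%N]/(2 ^ 12)%N leq_exp2r.
have e7 : (128 <= r.-1 ^ 7)%N by rewrite -[128%N]/(2 ^ 7)%N leq_exp2r.
have rE : r = r.-1.+1 by case: (r) r3.
move: r2 e12 e7 rE; move: (r.-1) => k k2 e12 e7 ->; split.
  have -> : (k ^ 14 = k ^ 12 * (k * k))%N by rewrite mulnn -expnD.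
  apply: leq_trans (_ : 4096 * (k * k) <= _)%N; last by rewrite leq_mul2r e12 orbT.
  have := leq_mul k2 k2; have := leq_mul k2 (leqnn k); lia.
rewrite expnS; apply: leq_trans (_ : k * 128 <= _)%N; first by lia.
by rewrite leq_mul2l e7 orbT.
Qed.

Lemma large_per_root i s : uniq s -> all (large_near (L i)) s -> (size s <= 22)%N.
Proof.
move=> us hs; rewrite leqNgt; apply/negP => s23.
set t := sort le2 s.
have ut : uniq t by rewrite sort_uniq.
have ht : all (large_near (L i)) t by rewrite all_sort.
have st : size t = size s by rewrite size_sort.
pose e p q := (r%:R - 1) * (ln (p.2%:~R : R) - 3 * ln M) <= ln (q.2%:~R : R) - 3 * ln M.
have set_ : sorted e t.
  have := sorted_le2 s; rewrite -/t; case: (t) ut ht => //= x t' ut' ht'.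
  by apply: path_le2_uniq ht' ut' => p q; apply: large_gap.
pose u n := ln ((nth (0, 0) t n).2%:~R : R) - 3 * ln M.
have r3R : 3 <= r%:R :> R by rewrite ler_nat.
have s0 : 0 < ln M by rewrite ln_gt0 // (lt_le_trans _ height_ge2) // ltr1n.
have M0 : 0 < M by apply: lt_le_trans height_ge2.
have near n : (n < size t)%N -> large_near (L i) (nth (0, 0) t n).
  by move=> nt; apply: (allP ht); rewrite mem_nth.
have ustep n : (n.+1 < size t)%N -> (r%:R - 1) * u n <= u n.+1.
  by move=> nt; have /sortedP := set_; apply.
have uk k n : (k + n < size t)%N -> (r%:R - 1) ^+ n * u k <= u (k + n)%N.
  elim: n => [|n IH] kn; first by rewrite addn0 mul1r.
  rewrite addnS in kn *; apply: le_trans (ustep _ kn); rewrite exprS -mulrA ler_wpM2l //.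
    by rewrite subr_ge0 (le_trans _ r3R) // ler1n.
  by apply: IH; apply: ltnW.
have rp : r.-1%:R = r%:R - 1 :> R.
  by rewrite -subn1 natrB //; case: (r) r3.
have [n14 n8] := large_steps.
have c14 : 1000 * r%:R ^+ 2 <= (r%:R - 1) ^+ 14 :> R.
  by rewrite -rp -!natrX -natrM ler_nat -mulnn.
have c8 : 66 * r%:R <= (r%:R - 1) ^+ 8 :> R.
  by rewrite -rp -natrX -natrM ler_nat.
have u0 : ln M <= u 0%N.
  have /and4P [_ p0 pM _] : large_near (L i) (nth (0, 0) t 0) by apply: near;
    rewrite st; case: (size s) s23.
  have := pM; rewrite -ler_ln ?posrE ?exprn_gt0 ?ltr0z // lnXn // /u -mulr_natl.
  by move: (ln _) (ln _) => a b; lra.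
have u14 : 1000 * r%:R ^+ 2 * ln M <= u 14.
  apply: le_trans (uk 0%N 14 _); last by rewrite st (leq_trans _ s23).
  apply: ler_pM => //; first by rewrite mulr_ge0 ?exprn_ge0.
  exact: ltW.
have u22 : 66 * r%:R * u 14 <= u 22.
  apply: le_trans (uk 14%N 8 _); last by rewrite st.
  by rewrite ler_wpM2r // (le_trans _ u14) // !mulr_ge0 ?exprn_ge0 // ltW.
have [f [sf fx fM]] := thue_form_poly r3 Lform.
have aprox p : large_near (L i) p ->
    nc (lroot (L i) - p.1%:~R / p.2%:~R) <= M ^+ r.-1 / p.2%:~R ^+ r.
  case/and4P => _ p0 _ pe; have y0 : 0 < p.2%:~R :> R by rewrite ltr0z.
  have p2 : (p.2%:~R : R[i]) != 0 by rewrite intr_eq0 gt_eqF.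
  have -> : lroot (L i) - p.1%:~R / p.2%:~R =
      - ((p.1%:~R - lroot (L i) * p.2%:~R) / p.2%:~R) by field.
  rewrite ncN ncM ncV nc_int (gtr0_norm p0) ler_pdivlMr ?exprn_gt0 //.
  have -> : (p.2%:~R : R) ^+ r = p.2%:~R * p.2%:~R ^+ r.-1.
    by rewrite -exprS prednK //; case: (r) r3.
  by rewrite mulrA divfK ?gt_eqF.
have near14 : large_near (L i) (nth (0, 0) t 14) by apply: near;
  rewrite st (leq_trans _ s23).
have near22 : large_near (L i) (nth (0, 0) t 22) by apply: near; rewrite st.
have s3 : 3 * ln M <= u 14%N.
  apply: le_trans _ u14; apply: ler_wpM2r; first exact: (ltW s0).
  have : 9 <= r%:R ^+ 2 :> R by rewrite -natrX ler_nat (leq_sqr 3).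
  by move: (_ ^+ 2) => a; lra.
have q10 : 0 < (nth (0, 0) t 14).2 by case/and4P: near14.
have q20 : 0 < (nth (0, 0) t 22).2 by case/and4P: near22.
have ldeg := (Lform.2 i).2.
have H1 := thue_gap r3 ldeg sf (fx i) fM (nc_lroot_le r3 Lform i) hM q10 q20.
have H2 := H1 _ _ (aprox _ near14) (aprox _ near22).
apply: H2.
- by apply: le_trans u14 _; rewrite /u gerBl mulr_ge0 // ltW.
- apply: le_trans (_ : u 22 <= _); last by rewrite /u gerBl mulr_ge0 // ltW.
  (* The 33 of [thue_gap] is doubled because ln q1 = u 14 + 3 ln M <= 2 u 14. *)
  apply: le_trans _ u22; have -> : 66 * r%:R * u 14 = 33 * r%:R * (2 * u 14) by ring.
  rewrite ler_wpM2l ?mulr_ge0 //; move: s3; rewrite /u; move: (ln _) (ln _) => a b.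
  by lra.
Qed.
End LargeCount.

(** * Primitive solutions of a form of large discriminant *)

Lemma size_le_sum_count (T : eqType) (I : finType) (P : I -> pred T) (s : seq T) :
  (forall p, p \in s -> exists i, P i p) -> (size s <= \sum_i count (P i) s)%N.
Proof.
elim: s => [|p s IH] h //=; rewrite big_split /= -add1n leq_add //.
  have [i Pi] := h p (mem_head _ _).
  by rewrite (bigD1 i) //= Pi.
by apply: IH => q qs; apply: h; rewrite inE qs orbT.
Qed.

Lemma size_sign_split (s : seq (int * int)) :
  size s = (count (fun p => (0 < p.2)%R) s + count (fun p => (p.2 < 0)%R) s
    + count (fun p => p.2 == 0%R) s)%N.
Proof. by elim: s => //= p t ->; case: (ltgtP p.2 0) => _ /=; lia. Qed.

Section Core.
Variables (R : realType) (r : nat).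
Hypothesis r3 : (3 <= r)%N.
Implicit Types (L : 'I_r -> R[i] * R[i]) (p q u v : int * int).

(* The factor 6 absorbs the constant 2 * 3^r of small_count, so that the bound on
   the small solutions only involves logarithms of quantities >= e^(20 r). *)
Definition Bcst : R := 6 * expR 20.

Definition prim_sol L (h : R) p : bool :=
  coprimez p.1 p.2 && (nc (\prod_i lf (L i) p) <= h).

Lemma Bcst_ge : 2 ^+ 20 <= Bcst.
Proof.
have e1 : 2 <= expR 1 :> R by apply: le_trans (expR_ge1Dx 1);
  rewrite -[X in X <= _]/(1 + 1).
have -> : Bcst = 6 * expR 1 ^+ 20 by rewrite /Bcst -expRM_natl mulr1.
have : 2 ^+ 20 <= expR 1 ^+ 20 :> R by rewrite lerXn2r ?nnegrE ?expR_ge0.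
have : 0 <= expR 1 ^+ 20 :> R by rewrite exprn_ge0 ?expR_ge0.
by move: (_ ^+ 20) (expR 1 ^+ 20) => a b; clear; lra.
Qed.

Lemma height_ge_disc L (c : R) : 0 <= c ->
  2 ^+ npairs r * c ^+ r.-1 <= disc1 L -> c <= height L.
Proof.
move=> c0 /le_trans /(_ (disc1_le L)); rewrite ler_pM2l ?exprn_gt0 //.
rewrite ler_pXn2r ?nnegrE //; first by case: (r) r3 => [|[|]].
by apply: prodr_ge0 => i _; apply: lmax_ge0.
Qed.

Section Reduced.
Variables (L : 'I_r -> R[i] * R[i]) (h l : R).
Hypotheses (Lform : thue_form L) (h1 : 1 <= h) (l1 : 1 <= l) (hl : ln h <= r%:R * l).
Hypothesis hD : 2 ^+ npairs r * (Bcst ^+ r * h) ^+ r.-1 <= disc1 L.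
Hypothesis Lmin : forall u v, det2 u v = 1 ->
  height L / 2 <= height (fun i => lsubst (L i) u v).
Local Notation M := (height L).

Let B0 : 0 < Bcst. Proof. by apply: lt_le_trans Bcst_ge; rewrite exprn_gt0. Qed.
Let h0 : 0 < h. Proof. by apply: lt_le_trans h1. Qed.
Let Bh : Bcst ^+ r * h <= M.
Proof. by apply: height_ge_disc hD; rewrite mulr_ge0 ?exprn_ge0 // ltW. Qed.
Let hM : 2 ^+ (20 * r) <= M.
Proof.
apply: le_trans Bh; rewrite exprM.
apply: le_trans (_ : Bcst ^+ r <= _).
  by rewrite lerXn2r ?nnegrE ?(ltW B0) ?exprn_ge0 ?Bcst_ge.
by rewrite ler_peMr // exprn_ge0 // ltW.
Qed.
Let M0 : 0 < M. Proof. by apply: lt_le_trans hM; rewrite exprn_gt0. Qed.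
Let hleM : h <= M.
Proof.
apply: le_trans Bh; rewrite ler_peMl ?(ltW h0) // exprn_ege1 //.
by apply: le_trans Bcst_ge; rewrite exprn_ege1 // ler1n.
Qed.

(** Here ln M <= 6 r + r l + ln X, using ln 6 <= 6, and 20 r <= ln X. So n <= 4 r ln M / ln X is at
    most r (26 + l) / 5, which is below 3 r (1 + l) as l >= 1. *)
Lemma log_count (n : nat) (X : R) : expR 20 ^+ r <= X -> M <= 6 ^+ r * h * X ->
  X ^+ n <= (M ^+ 4) ^+ r -> n%:R <= 3 * r%:R * (1 + l).
Proof.
move=> X1 MX Xn.
have X0 : 0 < X by apply: lt_le_trans X1; rewrite exprn_gt0 ?expR_gt0.
have rp : 0 < r%:R :> R by rewrite ltr0n; case: (r) r3.
have lX : 20 * r%:R <= ln X.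
  rewrite -(ler_expR) lnK ?posrE // mulrC expRM_natl //.
have lM : ln M <= 6 * r%:R + r%:R * l + ln X.
  have : ln M <= ln (6 ^+ r * h * X).
    by rewrite ler_ln ?posrE // !mulr_gt0 ?exprn_gt0.
  rewrite !lnM ?posrE ?mulr_gt0 ?exprn_gt0 // lnXn // -[_ *+ r]mulr_natl.
  have : r%:R * ln 6 <= r%:R * 6 :> R.
    by rewrite ler_pM2l // ltW // ln_sublinear.
  by move: hl; lra.
have : ln (X ^+ n) <= ln ((M ^+ 4) ^+ r) by rewrite ler_ln ?posrE ?exprn_gt0.
rewrite -exprM !lnXn // -[_ *+ n]mulr_natl -[_ *+ (4 * r)]mulr_natl natrM => H.
have H2 : n%:R * ln X <= (r%:R * (26 + l) / 5) * ln X.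
  apply: le_trans H _.
  apply: le_trans (_ : 4 * r%:R * (6 * r%:R + r%:R * l + ln X) <= _).
    by rewrite ler_wpM2l // mulr_ge0 // ltW.
  have : r%:R * (6 + l) * (20 * r%:R) <= r%:R * (6 + l) * ln X.
    by rewrite ler_wpM2l // mulr_ge0 ?(ltW rp) // addr_ge0 // (le_trans _ l1).
  lra.
have lX0 : 0 < ln X by apply: lt_le_trans lX; rewrite mulr_gt0.
move: H2; rewrite ler_pM2r // => /le_trans; apply.
have : r%:R * 1 <= r%:R * l by rewrite ler_pM2l.
lra.
Qed.

Lemma positive_count s : uniq s -> all (fun p => prim_sol L h p && (0 < p.2)) s ->
  (size s)%:R <= 23 * r%:R + 3 * r%:R * (1 + l).
Proof.
move=> us hs.
have {}hs p : p \in s -> [/\ coprimez p.1 p.2, 0 < p.2 & nc (\prod_i lf (L i) p) <= h].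
  by move=> /(allP hs) /andP [/andP [? ?] ?].
pose small p := (p.2%:~R : R) <= M ^+ 4.
rewrite -(count_predC small) natrD.
have M2 := height_ge2 r3 hM.
have M1 : 1 <= M by apply: le_trans M2; rewrite ler1n.
have c1 : (count small s)%:R <= r%:R + 3 * r%:R * (1 + l).
  set X := M / 2 / (3 ^+ r * h).
  have X1 : expR 20 ^+ r <= X.
    rewrite /X ler_pdivlMr ?mulr_gt0 ?exprn_gt0 // ler_pdivlMr //.
    apply: le_trans Bh; rewrite /Bcst exprMn.
    have -> : (6 : R) ^+ r = 2 ^+ r * 3 ^+ r by rewrite -exprMn -natrM.
    have : (2 : R) <= 2 ^+ r.
      by rewrite -{1}(expr1 (2 : R)) ler_weXn2l ?ler1n //; case: (r) r3.
    move=> /(ler_wpM2r (_ : 0 <= 3 ^+ r * expR 20 ^+ r * h)) H.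
    apply: le_trans (le_trans (_ : _ <= _) (H _)) _.
    - by rewrite le_eqVlt; apply/orP; left; apply/eqP; ring.
    - by rewrite !mulr_ge0 ?exprn_ge0 ?expR_ge0 // ltW.
    - by rewrite le_eqVlt; apply/orP; left; apply/eqP; ring.
  have MX : M <= 6 ^+ r * h * X.
    have hn : 3 ^+ r * h != 0 by rewrite mulf_neq0 ?expf_neq0 ?gt_eqF.
    have -> : (6 : R) ^+ r = 2 ^+ r * 3 ^+ r by rewrite -exprMn -natrM.
    have -> : 2 ^+ r * 3 ^+ r * h * X = 2 ^+ r / 2 * M.
      by rewrite /X; field; apply/andP; split; rewrite ?expf_neq0 ?gt_eqF.
    rewrite ler_peMl ?(ltW M0) // ler_pdivlMr // mul1r.
    by rewrite -{1}(expr1 (2 : R)) ler_weXn2l ?ler1n //; case: (r) r3.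
  have X1' : 1 <= X by apply: le_trans X1;
    rewrite exprn_ege1 // (le_trans _ (expR_ge1Dx 20)) // lerDl.
  have nz i p : p != (0, 0) -> lf (L i) p != 0 by exact: thue_form_lf_neq0.
  have := small_count (fun i => (Lform.2 i).1) nz Lmin h0 X1'
    (filter_uniq small us) (exprn_ege1 4 M1).
  move=> /(_ _)/(log_count X1 MX) H.
  have {}H : (size (filter small s) - r)%:R <= 3 * r%:R * (1 + l).
    apply: H => p; rewrite mem_filter => /andP [sp /hs [? ? ?]]; split=> //.
  rewrite -size_filter; apply: le_trans (lerD (lexx _) H).
  by rewrite -natrD ler_nat -leq_subLR.
have c2 : (count (predC small) s)%:R <= 22 * r%:R :> R.
  have far : forall p, p \in filter (predC small) s -> exists i, large_near L (L i) p.
    move=> p; rewrite mem_filter /= -ltNge => /andP [pM /hs [cp p0 ph]].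
    have hD1 : 2 ^+ npairs r <= disc1 L.
      apply: le_trans hD; rewrite ler_peMr ?exprn_ge0 // exprn_ege1 //.
      by apply: le_trans h1 _; rewrite ler_peMl ?(ltW h0) // exprn_ege1 //;
        apply: le_trans Bcst_ge; rewrite exprn_ege1 // ler1n.
    have [i hi] := near_root r3 Lform h1 hleM hD1 p0 ph.
    by exists i; apply/and4P; split=> //; apply: ltW.
  have := size_le_sum_count far; rewrite -size_filter -(ler_nat R) => /le_trans; apply.
  rewrite -natrM ler_nat mulnC -[r in (r * _)%N]card_ord -sum_nat_const.
  apply: leq_sum => i _; rewrite -size_filter.
  by apply: (large_per_root r3 Lform hM (i := i)); rewrite ?filter_all // !filter_uniq.
have : 0 <= r%:R :> R by exact: ler0n.
by move: c1 c2; lra.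
Qed.

Lemma reduced_count s : uniq s -> all (prim_sol L h) s ->
  (size s)%:R <= 30 * r%:R * (1 + l).
Proof.
move=> us hs.
pose neg p : int * int := (- p.1, - p.2).
pose pos p := 0 < p.2; pose ngp p := p.2 < 0; pose zp p := p.2 == 0.
have posc : (size (filter pos s))%:R <= 23 * r%:R + 3 * r%:R * (1 + l).
  apply: positive_count; first exact: filter_uniq.
  by apply/allP => p; rewrite mem_filter => /andP [p0 /(allP hs) ->].
have negc : (size (filter ngp s))%:R <= 23 * r%:R + 3 * r%:R * (1 + l).
  rewrite -(size_map neg); apply: positive_count.
    rewrite map_inj_uniq ?filter_uniq // => -[a b] [c d] [].
    by move=> /oppr_inj -> /oppr_inj ->.
  apply/allP => q /mapP [p]; rewrite mem_filter => /andP [p0 /(allP hs) /andP [cp ph]] ->.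
  have {}p0 : p.2 < 0 := p0.
  rewrite /neg /prim_sol /= oppr_gt0 p0 andbT coprimezN coprimeNz cp /=.
  apply: le_trans ph; rewrite !nc_prod; apply: ler_prod => i _.
  rewrite nc_ge0 /= -ncN le_eqVlt; apply/orP; left; apply/eqP; congr nc.
  by rewrite /lf /= !rmorphN /=; ring.
(* On y = 0 the only primitive points are (1, 0) and (-1, 0). In total there are at most 46 r + 6 r
   (1 + l) + 2 points, within 30 r (1 + l) since 1 + l >= 2. *)
have zc : (size (filter zp s) <= 2)%N.
  have -> : 2%N = size [:: (1, 0); (-1, 0) : int * int] by [].
  apply: uniq_leq_size; first exact: filter_uniq.
  move=> [a b]; rewrite mem_filter /zp /= => /andP [/eqP -> /(allP hs) /andP [cp _]].
  move: cp; rewrite /coprimez /gcdz /= gcdn0 !inE !xpair_eqE eqxx !andbT; clear; lia.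
have sz : (size s <= size (filter pos s) + size (filter ngp s)
    + size (filter zp s))%N.
  by rewrite !size_filter size_sign_split.
have rp : 3 <= r%:R :> R by rewrite ler_nat.
have rl : r%:R * 1 <= r%:R * l by rewrite ler_wpM2l.
have : (size s)%:R <= (size (filter pos s))%:R + (size (filter ngp s))%:R
    + (size (filter zp s))%:R :> R by rewrite -!natrD ler_nat.
have : (size (filter zp s))%:R <= 2 :> R by rewrite ler_nat.
by move: posc negc; lra.
Qed.

End Reduced.

Definition comb u v p : int * int :=
  (u.1 * p.1 + v.1 * p.2, u.2 * p.1 + v.2 * p.2).

Lemma lf_comb (a : R[i] * R[i]) u v p : lf (lsubst a u v) p = lf a (comb u v p).
Proof. by rewrite /lf /lsubst /lf /comb /= !rmorphD !rmorphM /=; ring. Qed.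

Lemma comb_coprime u v p :
  coprimez (comb u v p).1 (comb u v p).2 -> coprimez p.1 p.2.
Proof.
have d1 := dvdz_gcdl p.1 p.2; have d2 := dvdz_gcdr p.1 p.2.
have : (gcdz p.1 p.2 %| gcdz (comb u v p).1 (comb u v p).2)%Z.
  by rewrite dvdz_gcd /comb /= !rpredD ?dvdz_mull.
by move=> + /eqP h; rewrite h dvdz1.
Qed.

Lemma comb_seq u v (s : seq (int * int)) :
  (forall p, p \in s -> exists q, p = comb u v q) -> exists t, s = map (comb u v) t.
Proof.
elim: s => [|p s IH] h; first by exists [::].
have [q ->] := h p (mem_head _ _).
have [|t ->] := IH; first by move=> x xs; apply: h; rewrite inE xs orbT.
by exists (q :: t).
Qed.

Lemma comb_count L h u v s (n : R) :
    (forall t, uniq t -> all (prim_sol (fun i => lsubst (L i) u v) h) t ->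
      (size t)%:R <= n) ->
    uniq s -> all (prim_sol L h) s ->
    (forall p, p \in s -> exists q, p = comb u v q) ->
  (size s)%:R <= n.
Proof.
move=> hn us hs /comb_seq [t sE]; rewrite sE size_map; apply: hn.
  by apply: (@map_uniq _ _ (comb u v)); rewrite -sE.
apply/allP => q qt; have : comb u v q \in s by rewrite sE map_f.
move=> /(allP hs) /andP [/comb_coprime cq ph]; rewrite /prim_sol cq /=.
by rewrite (eq_bigr (fun i => lf (L i) (comb u v q))) // => i _; rewrite lf_comb.
Qed.

Lemma det2_comb u v u' v' : det2 (comb u v u') (comb u v v') = det2 u v * det2 u' v'.
Proof. by rewrite /det2 /comb /=; ring. Qed.

Lemma lsubst_comb (a : R[i] * R[i]) u v u' v' :
  lsubst (lsubst a u v) u' v' = lsubst a (comb u v u') (comb u v v').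
Proof. by rewrite [LHS]/lsubst !lf_comb. Qed.

(** Nothing is said about the infimum of the heights being attained: a height below inf + c is
    taken, and c <= inf makes it at most twice the infimum. *)
Lemma ex_reduced_basis L (c : R) : 0 < c ->
    (forall u v, det2 u v = 1 -> c <= height (fun i => lsubst (L i) u v)) ->
  exists u v, det2 u v = 1 /\ forall u' v', det2 u' v' = 1 ->
    height (fun i => lsubst (L i) u v) / 2 <= height (fun i => lsubst (L i) u' v').
Proof.
move=> c0 hc.
pose S := [set x : R | exists u v, det2 u v = 1 /\ x = height (fun i => lsubst (L i)
  u v)].
have Slb : lbound S c by move=> x [u [v [/hc + ->]]].
have S0 : S !=set0.
  by exists (height (fun i => lsubst (L i) (1, 0) (0, 1))); exists (1, 0), (0, 1).
have hinf : has_inf S by split=> //; exists c.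
have [x [u [v [duv xE]]] xlt] := inf_adherent c0 hinf.
exists u, v; split=> // u' v' d'; rewrite -xE ler_pdivrMr //.
have h1 : inf S <= height (fun i => lsubst (L i) u' v').
  by apply: ge_inf; [exists c|exists u', v'].
have h2 : c <= inf S by apply: lb_le_inf.
lra.
Qed.

Lemma core_count L (h l : R) s :
    thue_form L -> 1 <= h -> 1 <= l -> ln h <= r%:R * l ->
    2 ^+ npairs r * (Bcst ^+ r * h) ^+ r.-1 <= disc1 L ->
    uniq s -> all (prim_sol L h) s ->
  (size s)%:R <= 30 * r%:R * (1 + l).
Proof.
move=> Lform h1 l1 hl hD us hs.
have h0 : 0 < h by apply: lt_le_trans h1.
have B0 : 0 < Bcst by apply: lt_le_trans Bcst_ge; rewrite exprn_gt0.
have disc_inv u v : det2 u v = 1 -> disc1 (fun i => lsubst (L i) u v) = disc1 L.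
  by move=> duv; rewrite disc1_subst duv normr1 expr1n mulr1.
have [u [v [duv umin]]] : exists u v, det2 u v = 1 /\ forall u' v', det2 u' v' = 1 ->
    height (fun i => lsubst (L i) u v) / 2 <= height (fun i => lsubst (L i) u' v').
  apply: (@ex_reduced_basis L (Bcst ^+ r * h)); first by rewrite mulr_gt0 ?exprn_gt0.
  by move=> u v duv; apply: height_ge_disc;
    rewrite ?disc_inv // mulr_ge0 ?exprn_ge0 // ltW.
apply: (comb_count (u := u) (v := v) _ us hs).
  move=> t; apply: reduced_count => //.
  - by apply: thue_form_subst; rewrite ?duv // ltnW.
  - by rewrite disc_inv.
  - move=> u' v' d'; apply: le_trans (umin (comb u v u') (comb u v v') _) _.
      by rewrite det2_comb duv d'.
    by rewrite /height; under eq_bigr do rewrite -lsubst_comb.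
(* The inverse of the unimodular matrix with columns u, v, applied to p. *)
move=> p _; exists (v.2 * p.1 - v.1 * p.2, - u.2 * p.1 + u.1 * p.2).
move: duv; rewrite /det2 /comb /= => duv; case: p => a b /=; congr (_, _).
  have -> : u.1 * (v.2 * a - v.1 * b) + v.1 * (- u.2 * a + u.1 * b) =
    (u.1 * v.2 - u.2 * v.1) * a by ring.
  by rewrite duv mul1r.
have -> : u.2 * (v.2 * a - v.1 * b) + v.2 * (- u.2 * a + u.1 * b) =
    (u.1 * v.2 - u.2 * v.1) * b by ring.
by rewrite duv mul1r.
Qed.

End Core.

(** * Sublattices and common factors *)

Lemma coprime_odd (m n : nat) : coprime m n -> odd m || odd n.
Proof.
move=> cmn; apply: contraT; rewrite negb_or -!dvdn2 => /andP [d1 d2].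
by have := dvdn_gcd 2 m n; rewrite d1 d2 (eqP cmn).
Qed.

Lemma odd_solve (k : nat) (x y : int) : odd (absz x) ->
  exists a : 'I_(2 ^ k), ((2 ^ k)%N%:Z %| y - a%:Z * x)%Z.
Proof.
move=> ox; set n := (2 ^ k)%N%:Z.
have n0 : n != 0 by rewrite eqz_nat expn_eq0.
have cx : coprimez x n.
  by rewrite coprimezE /= coprime_sym coprimeXl // coprime2n.
have [u [v uv]] := Bezoutz x n.
have {}uv : u * x + v * n = 1 by rewrite uv; apply/eqP; exact: cx.
have mn : (absz (y * u %% n)%Z < 2 ^ k)%N.
  by have := modz_ge0 (y * u) n0; have := ltz_mod (y * u) n0; rewrite /n; lia.
exists (Ordinal mn); rewrite /= gez0_abs ?modz_ge0 //.
apply/dvdzP; exists (y * v + (y * u %/ n)%Z * x).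
have := divz_eq (y * u) n; set m := (_ %% _)%Z; set d := (_ %/ _)%Z => e.
have -> : m = y * u - d * n by rewrite e; ring.
have y1 : y = y * (u * x + v * n) by rewrite uv mulr1.
by rewrite {1}y1; ring.
Qed.

Section Lattices.
Variables (R : realType) (r : nat).
Hypothesis r3 : (3 <= r)%N.
Implicit Types (L : 'I_r -> R[i] * R[i]) (p q : int * int) (s : seq (int * int)).
Local Notation B := (Bcst R).

(* For coprime x, y, one of x, y is odd, hence invertible modulo 2^k: the point
   lies on a line y = a x or x = a y modulo 2^k. *)
Definition latu (k : nat) (i : bool * 'I_(2 ^ k)) : int * int :=
  if i.1 then (1, (i.2 : nat)%:Z) else ((i.2 : nat)%:Z, 1).
Definition latv (k : nat) (i : bool * 'I_(2 ^ k)) : int * int :=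
  if i.1 then (0, (2 ^ k)%N%:Z) else ((2 ^ k)%N%:Z, 0).
Definition inlat (k : nat) (i : bool * 'I_(2 ^ k)) : pred (int * int) := fun p =>
  if i.1 then ((2 ^ k)%N%:Z %| p.2 - (i.2 : nat)%:Z * p.1)%Z
  else ((2 ^ k)%N%:Z %| p.1 - (i.2 : nat)%:Z * p.2)%Z.

Lemma inlatP k (i : bool * 'I_(2 ^ k)) p : inlat i p ->
  exists q, p = comb (latu i) (latv i) q.
Proof.
case: i p => [[] a] [x y]; rewrite /inlat /latu /latv /comb /= => /dvdzP [z e].
  by exists (x, z); rewrite /=; congr (_, _); [ring|rewrite mulrC in e;
    move: e => /eqP; rewrite subr_eq => /eqP ->; ring].
by exists (y, z); rewrite /=; congr (_, _); [move: e => /eqP;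
  rewrite subr_eq => /eqP ->; ring|ring].
Qed.

Lemma lattice_count L (h l : R) (k : nat) s :
    thue_form L -> 1 <= h -> 1 <= l -> ln h <= r%:R * l ->
    2 ^+ npairs r * (B ^+ r * h) ^+ r.-1 <= disc1 L * (2 ^+ k) ^+ npairs r ->
    uniq s -> all (prim_sol L h) s ->
  (size s)%:R <= 2 ^+ k.+1 * (30 * r%:R * (1 + l)).
Proof.
move=> Lform h1 l1 hl hD us hs.
have cover p : p \in s -> exists i : bool * 'I_(2 ^ k), inlat i p.
  move=> /(allP hs) /andP [+ _]; rewrite coprimezE => /coprime_odd /orP [] od.
    by have [a ha] := odd_solve k p.2 od; exists (true, a).
  by have [a ha] := odd_solve k p.1 od; exists (false, a).
have := size_le_sum_count cover; rewrite -(ler_nat R) => /le_trans; apply.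
rewrite natr_sum.
apply: le_trans (_ : \sum_(i : bool * 'I_(2 ^ k)) (30 * r%:R * (1 + l)) <= _).
  apply: ler_sum => i _; rewrite -size_filter.
  have ti : `|det2 (latu i) (latv i)| = (2 ^ k)%N%:Z.
    by case: i => [[] a];
      rewrite /det2 /latu /latv /= ?mulr0 ?mul1r ?subr0 ?sub0r ?normrN.
  apply: (@comb_count R r L h (latu i) (latv i)); last first.
  - by move=> p; rewrite mem_filter => /andP [/inlatP].
  - by apply/allP => p; rewrite mem_filter => /andP [_ /(allP hs)].
  - exact: filter_uniq.
  move=> t; apply: core_count => //.
    apply: thue_form_subst => //; first exact: ltnW.
    by rewrite -normr_eq0 ti eqz_nat expn_eq0.
  by rewrite disc1_subst ti -pmulrn natrX.
rewrite sumr_const card_prod card_bool card_ord -[X in X <= _]mulr_natl natrM natrX.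
by rewrite exprS.
Qed.

Lemma ex_pow2 (X : R) : 0 <= X -> exists k, X <= 2 ^+ k /\ 2 ^+ k <= 1 + 2 * X.
Proof.
move=> X0.
have ex : exists n, X <= 2 ^+ n.
  have [n nX] : exists n : nat, X <= n%:R.
    by exists (Num.trunc X).+1; have /andP [_ /ltW] := truncn_itv X0.
  by exists n; apply: le_trans nX _; rewrite -natrX ler_nat ltnW // ltn_expl.
have [k hk kmin] := ex_minnP ex; exists k; split=> //.
case: k hk kmin => [|k] hk kmin; first by rewrite expr0 lerDl mulr_ge0.
have : ~~ (X <= 2 ^+ k) by apply/negP => /kmin; rewrite ltnn.
by rewrite -ltNge exprS; move: (2 ^+ k) => a; clear; lra.
Qed.

(* Delta is |D(F)|^(1/(r(r-1))); passing to a sublattice of index 2^k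
   multiplies it by 2^k. *)
Lemma primitive_count L (h H l Delta : R) s :
    thue_form L -> 1 <= h -> 0 < H -> H ^+ r = h -> 1 <= l -> ln h <= r%:R * l ->
    0 < Delta -> Delta ^+ npairs r = disc1 L ->
    uniq s -> all (prim_sol L h) s ->
  (size s)%:R <= (2 + 4 * (2 * (B * H) ^+ 2 / Delta)) * (30 * r%:R * (1 + l)).
Proof.
move=> Lform h1 H0 Hh l1 hl D0 DE us hs.
set X := 2 * (B * H) ^+ 2 / Delta.
have B0 : 0 < B by apply: lt_le_trans (Bcst_ge R); rewrite exprn_gt0.
have X0 : 0 <= X by rewrite divr_ge0 ?(ltW D0) // mulr_ge0 // sqr_ge0.
have [k [k1 k2]] := ex_pow2 X0.
apply: le_trans (lattice_count (k := k) Lform h1 l1 hl _ us hs) _.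
  (* As r (r - 1) = 2 [npairs r], the discriminant condition is the power [npairs r] of 2 (B H)^2 <=
     Delta 2^k. *)
  rewrite -DE -exprMn -Hh -exprMn -exprM -npairsE mulnC exprM -exprMn.
  rewrite lerXn2r ?nnegrE //.
  - by rewrite mulr_ge0 // sqr_ge0.
  - by rewrite mulr_ge0 ?exprn_ge0 // ltW.
  - by rewrite [Delta * _]mulrC -ler_pdivrMr.
rewrite ler_wpM2r //.
  by rewrite !mulr_ge0 // addr_ge0 // (le_trans _ l1).
by rewrite exprS; move: k2; clear; lra.
Qed.

Lemma sum_inv_sqr (n : nat) : \sum_(i < n) (i.+1%:R ^- 2 : R) <= 2.
Proof.
case: n => [|n]; first by rewrite big_ord0.
(* The sharper bound is what the induction can carry. *)
suff : \sum_(i < n.+1) (i.+1%:R ^- 2 : R) <= 2 - n.+1%:R^-1.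
  move=> /le_trans; apply; rewrite gerBl invr_ge0 ler0n //.
elim: n => [|n IH]; first by rewrite big_ord1 expr1n invr1; lra.
rewrite big_ord_recr /=; apply: le_trans (lerD IH (lexx _)) _.
have a0 : 0 < n.+1%:R :> R by rewrite ltr0n.
rewrite -[n.+2%:R]natr1; move: (n.+1%:R : R) a0 => a a0.
have a1 : 0 < a + 1 by rewrite addr_gt0.
rewrite -subr_ge0.
have -> : 2 - (a + 1)^-1 - (2 - a^-1 + (a + 1) ^- 2) = (a * (a + 1) ^+ 2)^-1.
  by field; rewrite ?gt_eqF.
by rewrite invr_ge0 mulr_ge0 ?exprn_ge0 // ltW.
Qed.

(** A solution of gcd g is g times a primitive solution for h / g^r, so H becomes H / g. The nonzero
    integral value of the form forces g^r <= h, that is g <= H; the sum of 1/g^2 is at most 2 and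
    turns the 4 of [primitive_count] into 8. *)
Lemma solution_count L (h H l Delta : R) s :
    thue_form L -> 1 <= h -> 0 < H -> H ^+ r = h -> 1 <= l -> ln h <= r%:R * l ->
    0 < Delta -> Delta ^+ npairs r = disc1 L ->
    uniq s -> (forall p, p \in s -> p != (0, 0) /\ nc (\prod_i lf (L i) p) <= h) ->
  (size s)%:R <= (2 * H + 8 * (2 * (B * H) ^+ 2 / Delta)) * (30 * r%:R * (1 + l)).
Proof.
move=> Lform h1 H0 Hh l1 hl D0 DE us hs.
set K := 30 * r%:R * (1 + l); set X := 2 * (B * H) ^+ 2 / Delta.
have K0 : 0 <= K by rewrite !mulr_ge0 // addr_ge0 // (le_trans _ l1).
have B0 : 0 < B by apply: lt_le_trans (Bcst_ge R); rewrite exprn_gt0.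
have X0 : 0 <= X by rewrite divr_ge0 ?(ltW D0) // mulr_ge0 // sqr_ge0.
pose G := Num.trunc H.
pose P (i : 'I_G) : pred (int * int) := fun p => gcdz p.1 p.2 == i.+1%:Z.
have lfZ (g : int) q i : lf (L i) (comb (g, 0) (0, g) q) = g%:~R * lf (L i) q.
  by rewrite /lf /comb /= !mul0r addr0 add0r !rmorphM /=; ring.
have prodZ (g : int) q : nc (\prod_i lf (L i) (comb (g, 0) (0, g) q)) =
    `|g|%:~R ^+ r * nc (\prod_i lf (L i) q).
  under eq_bigr do rewrite lfZ.
  by rewrite big_split prodr_const card_ord ncM ncX nc_int.
have gE p : exists q, p = comb (gcdz p.1 p.2, 0) (0, gcdz p.1 p.2) q.
  exists ((p.1 %/ gcdz p.1 p.2)%Z, (p.2 %/ gcdz p.1 p.2)%Z).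
  rewrite /comb /= !mul0r addr0 add0r ![gcdz _ _ * _]mulrC.
  by rewrite !divzK ?dvdz_gcdl ?dvdz_gcdr //; case: p.
have value_ge1 q : q != (0, 0) -> 1 <= nc (\prod_i lf (L i) q).
  move=> q0; have [m mE] := thue_form_value q Lform.
  rewrite mE; apply: nc_int_ge1; apply/eqP => m0; move: mE; rewrite m0 => /eqP.
  by rewrite prodf_seq_eq0 => /hasP [j _ /=];
    rewrite (negPf (thue_form_lf_neq0 r3 Lform j q0)).
have cover p : p \in s -> exists i, P i p.
  move=> /hs [p0 ph]; have [q pE] := gE p; set g := gcdz p.1 p.2 in pE.
  have g0 : 0 < g.
    rewrite lt_neqAle eq_sym gcdz_eq0 negb_and; apply/andP; split=> //.
    by move: p0; case: (p) => a b; rewrite xpair_eqE negb_and.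
  have q0 : q != (0, 0).
    by apply: contraNneq p0 => q0; rewrite pE q0 /comb /= !mulr0 addr0.
  have gH : g%:~R <= H.
    have : g%:~R ^+ r <= H ^+ r.
      rewrite Hh; apply: le_trans ph; rewrite pE prodZ gtr0_norm //.
      by rewrite ler_peMr ?value_ge1 // exprn_ge0 // ler0z ltW.
    rewrite ler_pXn2r ?nnegrE ?ler0z ?(ltW g0) ?(ltW H0) //.
    by case: (r) r3.
  have gG : ((absz g).-1 < G)%N.
    rewrite prednK; last by move: g0; clear; lia.
    by rewrite /G truncn_ge_nat ?(ltW H0).
  have gp : (0 < absz g)%N by rewrite absz_gt0 gt_eqF.
  by exists (Ordinal gG); rewrite /P /= -/g prednK.
have gE' (g : nat) q : gcdz (comb (g.+1%:Z, 0) (0, g.+1%:Z) q).1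
    (comb (g.+1%:Z, 0) (0, g.+1%:Z) q).2 = g.+1%:Z * gcdz q.1 q.2.
  by rewrite /comb /= !mul0r addr0 add0r /gcdz !abszM /= -muln_gcdr PoszM.
have := size_le_sum_count cover; rewrite -(ler_nat R) natr_sum => /le_trans; apply.
apply: le_trans (_ : \sum_(i < G) ((2 + 4 * (X * i.+1%:R ^- 2)) * K) <= _).
  apply: ler_sum => i _; rewrite -size_filter.
  have [t tE] : exists t, filter (P i) s = map (comb (i.+1%:Z, 0) (0, i.+1%:Z)) t.
    apply: comb_seq => p; rewrite mem_filter => /andP [/eqP Pp _].
    by have [q] := gE p; rewrite Pp => ->; exists q.
  have i0 : 0 < i.+1%:R :> R by rewrite ltr0n.
  have gH : i.+1%:R <= H by rewrite -truncn_ge_nat ?(ltW H0) // ltn_ord.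
  have hg1 : 1 <= h / i.+1%:R ^+ r.
    rewrite ler_pdivlMr ?exprn_gt0 // mul1r -Hh lerXn2r ?nnegrE ?(ltW H0) //.
  rewrite tE size_map.
  have -> : X * i.+1%:R ^- 2 = 2 * (B * (H / i.+1%:R)) ^+ 2 / Delta.
    have D0' := lt0r_neq0 D0; have := lt0r_neq0 i0.
    rewrite /X; move: (i.+1%:R : R) => c c0.
    by field; rewrite D0' c0.
  apply: (@primitive_count L (h / i.+1%:R ^+ r)) => //.
  - by rewrite divr_gt0.
  - by rewrite expr_div_n Hh.
  - apply: le_trans hl; rewrite ler_ln ?posrE ?(lt_le_trans _ hg1) ?(lt_le_trans _ h1) //.
    rewrite ler_pdivrMr ?exprn_gt0 // ler_peMr ?(le_trans _ h1) // exprn_ege1 //.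
    by rewrite ler1n.
  - by apply: (@map_uniq _ _ (comb (i.+1%:Z, 0) (0, i.+1%:Z))); rewrite -tE filter_uniq.
  apply/allP => q qt.
  have : comb (i.+1%:Z, 0) (0, i.+1%:Z) q \in filter (P i) s by rewrite tE map_f.
  rewrite mem_filter => /andP [/eqP Pq /hs [_ qh]]; apply/andP; split.
    have := gE' i q; rewrite Pq -[LHS]mulr1 => /mulfI => /(_ isT) e.
    by rewrite /coprimez -e.
  by rewrite ler_pdivlMr ?exprn_gt0 // mulrC; move: qh; rewrite prodZ.
rewrite -mulr_suml ler_wpM2r // big_split /= sumr_const card_ord -mulr_sumr -mulr_sumr.
apply: lerD.
  by rewrite -[X in X <= _]mulr_natr ler_wpM2l // /G truncn_le ltW.
have := ler_wpM2l X0 (sum_inv_sqr G); move: (_ * \sum_(i < G) _) => y; clear -X0; lra.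
Qed.

End Lattices.

(** * From the form to its linear factors *)

Section Homogenization.
Variables (K S : comNzRingType) (phi : {rmorphism K -> S}) (P Q : S).

Definition hom (n : nat) (p : {poly K}) : S :=
  \sum_(k < n.+1) phi p`_k * (P ^+ k * Q ^+ (n - k)).

Lemma homD n p q : hom n (p + q) = hom n p + hom n q.
Proof.
by rewrite -big_split; apply: eq_bigr => k _; rewrite coefD rmorphD mulrDl.
Qed.

Lemma hom0 n : hom n 0 = 0.
Proof. by rewrite /hom big1 // => k _; rewrite coef0 rmorph0 mul0r. Qed.

Lemma hom_sum n (I : Type) (s : seq I) (F : I -> {poly K}) :
  hom n (\sum_(i <- s) F i) = \sum_(i <- s) hom n (F i).
Proof. by rewrite (big_morph _ (homD n) (hom0 n)). Qed.

Lemma hom_monomial n (c : K) k : (k <= n)%N ->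
  hom n (c *: 'X^k) = phi c * (P ^+ k * Q ^+ (n - k)).
Proof.
rewrite -ltnS => kn; rewrite /hom (bigD1 (Ordinal kn)) //= big1 => [|j jk].
  by rewrite coefZ coefXn eqxx mulr1 addr0.
rewrite coefZ coefXn (_ : (j : nat) == k = false) ?mulr0 ?rmorph0 ?mul0r //.
by apply: contraNF jk => /eqP jk; apply/eqP/val_inj.
Qed.

Lemma poly_wide n (p : {poly K}) : (size p <= n)%N -> p = \sum_(i < n) p`_i *: 'X^i.
Proof.
move=> sp; rewrite -poly_def; apply/polyP => i; rewrite coef_poly.
by case: ltnP => // ni; rewrite nth_default // (leq_trans sp).
Qed.

Lemma homM n m (p q : {poly K}) : (size p <= n.+1)%N -> (size q <= m.+1)%N ->
  hom (n + m) (p * q) = hom n p * hom m q.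
Proof.
move=> sp sq; rewrite {1}(poly_wide sp) {1}(poly_wide sq) mulr_suml hom_sum.
rewrite [hom n p]/hom mulr_suml; apply: eq_bigr => i _.
rewrite mulr_sumr hom_sum [hom m q]/hom mulr_sumr; apply: eq_bigr => j _.
have im := ltn_ord i; have jm := ltn_ord j.
rewrite -scalerAl -scalerAr scalerA -exprD hom_monomial ?leq_add // rmorphM.
have -> : (n + m - (i + j) = (n - i) + (m - j))%N by move: im jm; clear; lia.
by rewrite !exprD; ring.
Qed.

End Homogenization.

Lemma mmap_dehomog (S : comNzRingType) (phi : {rmorphism int -> S}) (x y : S)
    (r : nat) (F : {mpoly int[2]}) : F \is r.-homog ->
  mmap phi (pair_val x y) F = hom phi x y r (dehomog F).
Proof.
move=> /dhomogP Fr; rewrite /dehomog /mmap hom_sum [LHS]big_seq [RHS]big_seq.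
apply: eq_bigr => m mF; rewrite /mmap1 !big_ord_recl !big_ord0 /pair_val /=.
have := Fr m mF; rewrite /= mdegE !big_ord_recl big_ord0 addn0 => mr.
rewrite !expr1n !mulr1 mul_polyC hom_monomial; last by rewrite -mr leq_addr.
by rewrite -[in RHS]mr addKn.
Qed.

Section IrreducibleForm.
Variables (r : nat) (F : {mpoly int[2]}).
Hypotheses (r2 : (2 <= r)%N) (Fhom : F \is r.-homog) (Firr : irreducible_form F).
Local Notation f := (dehomog F).
Local Notation fq := (map_poly intr f : {poly rat}).

(* A factorization of F(x, 1), with room for the degrees, homogenizes to one of F
   whose factors vanish at (0, 0), so are not units. *)
Lemma dehomog_no_factor (d e : {poly rat}) (n m : nat) :
    (0 < n)%N -> (0 < m)%N -> (n + m = r)%N -> (size d <= n.+1)%N -> (size e <= m.+1)%N ->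
  fq <> d * e.
Proof.
move=> n0 m0 nm sd se fE; have [_ _ Hirr] := Firr.
pose H := hom (@mpolyC 2 rat) ('X_ord0 : {mpoly rat[2]}) ('X_(lift ord0 ord0)).
have FE : map_mpoly intr F = H n d * H m e.
  rewrite -homM // nm -fE /map_mpoly.
  transitivity (mmap ((@mpolyC 2 rat) \o intr) (pair_val 'X_ord0 'X_(lift ord0 ord0)) F).
    rewrite /mmap; apply: eq_bigr => mm _; congr (_ * _).
    by rewrite /mmap1 !big_ord_recl !big_ord0.
  rewrite (mmap_dehomog _ _ _ Fhom); apply: eq_bigr => k _.
  by rewrite coef_map.
have nounit k p : (0 < k)%N -> H k p \isn't a GRing.unit.
  move=> k0; apply/negP => /(rmorph_unit (meval (fun=> 0))).
  rewrite /H /hom rmorph_sum big1 ?unitr0 // => j _.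
  rewrite !rmorphM !rmorphXn /= !mevalXU !expr0n.
  have [j0|j0] := eqVneq (j : nat) 0%N; last by rewrite mul0r mulr0.
  by rewrite j0 subn0 gtn_eqF // !mulr0.
have [u|u] := Hirr _ _ FE.
  by have := nounit _ d n0; rewrite u.
by have := nounit _ e m0; rewrite u.
Qed.

Lemma size_map_intr (K : numFieldType) (p : {poly int}) :
  size (map_poly intr p : {poly K}) = size p.
Proof. by rewrite size_map_inj_poly //; apply: intr_inj. Qed.

Lemma size_dehomog : size f = r.+1.
Proof.
apply/eqP; rewrite eqn_leq; apply/andP; split.
  apply: leq_trans (size_sum _ _ _) _; apply/bigmax_leqP_seq => m mF _.
  rewrite mul_polyC (leq_trans (size_scale_leq _ _)) //.
  rewrite /mmap1 !big_ord_recl big_ord0 /pair_val /= !expr1n !mulr1 size_polyXn ltnS.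
  move/dhomogP: Fhom => /(_ m mF); rewrite /= mdegE !big_ord_recl big_ord0 addn0 => <-.
  exact: leq_addr.
rewrite ltnNge; apply/negP => sf.
(* The constant 1 homogenized in degree 1 is y: a drop in the degree of F(x, 1) would make y a
   factor of F. *)
apply: (@dehomog_no_factor 1 fq 1 r.-1) => //.
- by case: (r) r2 => [|[|]].
- by rewrite add1n prednK // ltnW.
- by rewrite size_poly1.
- by rewrite size_map_intr prednK // ltnW.
- by rewrite mul1r.
Qed.

(** A nonzero G of degree less than r with a root in common with F(x, 1) would have with it a
    nonconstant gcd of degree less than r, hence a proper factor of F(x, 1). *)
Lemma dehomog_algdeg (C : numFieldType) (x : C) :
  (map_poly intr f).[x] = 0 -> algdeg r x.
Proof.
move=> fx G sG Gx; apply/eqP; apply: contraT => G0.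
have sf : size fq = r.+1 by rewrite size_map_intr size_dehomog.
have f0 : fq != 0 by rewrite -size_poly_eq0 sf.
pose d := gcdp G fq.
have d0 : d != 0 by rewrite gcdp_eq0 negb_and G0.
have rd : root (map_poly ratr d) x.
  rewrite gcdp_map root_gcd; apply/andP; split; apply/eqP => //.
  by rewrite map_poly_int_rat.
have sd : (1 < size d)%N.
  rewrite ltnNge; apply/negP => /size1_polyC dE; move: rd d0; rewrite dE map_polyC.
  by rewrite rootC fmorph_eq0 polyC_eq0 => ->.
have sdr : (size d <= r)%N by apply: leq_trans (dvdp_leq G0 (dvdp_gcdl _ _)) sG.
have /dvdpP [e fE] := dvdp_gcdr G fq; rewrite -/d in fE.
have e0 : e != 0 by apply: contraNneq f0 => e0; rewrite fE e0 mul0r.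
have se : (size e + size d = r.+2)%N.
  move: sf; rewrite fE size_mul // => h; rewrite -h prednK // addn_gt0.
  by rewrite !size_poly_gt0 e0.
have d1 : (0 < size d)%N by rewrite size_poly_gt0.
have e1 : (0 < size e)%N by rewrite size_poly_gt0.
exfalso; apply: (@dehomog_no_factor e d (size e).-1 (size d).-1) => //.
- by move: se sdr; move: (size e) (size d); clear => a b; lia.
- by move: sd; move: (size d); clear => a; lia.
- by move: se e1 d1; move: (size e) (size d); clear => a b; lia.
- by rewrite prednK.
- by rewrite prednK.
Qed.

Lemma dehomog_lead : f`_r = mcoeff (U_(ord0) *+ r)%MM F.
Proof.
rewrite /dehomog /mmap coef_sum.
transitivity (\sum_(m <- msupp F) F@_m * (m == (U_(ord0) *+ r)%MM)%:R).
  rewrite big_seq [RHS]big_seq; apply: eq_bigr => m mF.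
  rewrite mul_polyC coefZ /mmap1 !big_ord_recl big_ord0 /pair_val /= !expr1n !mulr1.
  rewrite coefXn; congr (_ * (_ : bool)%:R).
  move/dhomogP: Fhom => /(_ m mF); rewrite /= mdegE !big_ord_recl big_ord0 addn0 => mr.
  apply/eqP/eqP => [rm|->]; last by rewrite mulmnE mnm1E eqxx mul1n.
  apply/mnmP => i; rewrite mulmnE mnm1E.
  case: (unliftP ord0 i) => [j ->|->]; last by rewrite eqxx mul1n.
  rewrite (negPf (neq_lift _ _)) mul0n (ord1 j).
  by apply: (@addnI (m ord0)); rewrite addn0; exact: etrans mr rm.
have [cF|cF] := boolP ((U_(ord0) *+ r)%MM \in msupp F).
  rewrite (bigD1_seq _ cF (msupp_uniq F)) /= eqxx mulr1 big1 ?addr0 // => m mn.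
  by rewrite (negPf mn) mulr0.
rewrite (memN_msupp_eq0 cF) big_seq big1 // => m mF.
by rewrite (_ : (m == _) = false) ?mulr0 //; apply: contraNF cF => /eqP <-.
Qed.

End IrreducibleForm.

(** * The linear factors of F and its discriminant *)

Section Translation.
Variables (R : realType) (r : nat) (F : {mpoly int[2]}).
Hypotheses (r3 : (3 <= r)%N) (Fhom : F \is r.-homog) (Firr : irreducible_form F).
Local Notation f := (dehomog F).
Local Notation alpha := (form_roots R F).
Let r2 : (2 <= r)%N := ltnW r3.
Let a0 : R[i] := (f`_r)%:~R.

Lemma form_rootsE : map_poly intr f = a0 *: \prod_(z <- alpha) ('X - z%:P).
Proof.
rewrite /form_roots; case: closed_field_poly_normal => s /= {1}->; congr (_ *: _).
rewrite lead_coefE size_map_intr (size_dehomog r2 Fhom Firr) /=.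
by rewrite coef_map.
Qed.

Lemma a0_neq0 : a0 != 0.
Proof.
rewrite intr_eq0; have sf := size_dehomog r2 Fhom Firr.
have := lead_coef_eq0 f; rewrite lead_coefE sf /= => ->.
by rewrite -size_poly_eq0 sf.
Qed.

Lemma size_form_roots : size alpha = r.
Proof.
have := congr1 (fun p : {poly R[i]} => size p) form_rootsE.
rewrite size_map_intr (size_dehomog r2 Fhom Firr) size_scale ?a0_neq0 //.
by rewrite size_prod_XsubC => -[].
Qed.

(* The leading coefficient of the form is put into the first linear factor. *)
Definition form_factor (i : 'I_r) : R[i] * R[i] :=
  let c := if i == 0%N :> nat then a0 else 1 in (c, - (c * alpha`_i)).

Let cst (i : 'I_r) : R[i] := if i == 0%N :> nat then a0 else 1.

Let cst_neq0 i : cst i != 0.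
Proof. by rewrite /cst; case: ifP => _; rewrite ?a0_neq0 ?oner_eq0. Qed.

Let prod_cst : \prod_i cst i = a0.
Proof.
have h0 : (0 < r)%N by apply: ltnW.
rewrite (bigD1 (Ordinal h0)) //= /cst /= big1 ?mulr1 // => j j0.
by rewrite ifN //; apply: contra j0 => /eqP j0; apply/eqP/val_inj.
Qed.

Lemma form_factor_prod :
  map_poly intr f = \prod_i ((form_factor i).1 *: 'X + (form_factor i).2%:P).
Proof.
rewrite form_rootsE (big_nth 0) size_form_roots big_mkord.
transitivity (\prod_i ((cst i)%:P * ('X - (alpha`_i)%:P))).
  rewrite big_split /= -mul_polyC; congr (_ * _).
  by rewrite -prod_cst rmorph_prod.
by apply: eq_bigr => i _; rewrite /form_factor -/(cst i) polyCN polyCM -mul_polyC; ring.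
Qed.

Lemma form_factor_root i : lroot (form_factor i) = alpha`_i.
Proof.
by rewrite /lroot /form_factor -/(cst i) opprK mulrAC divff ?mul1r ?cst_neq0.
Qed.

Lemma form_roots_algdeg (i : 'I_r) : algdeg r (alpha`_i).
Proof.
apply: (dehomog_algdeg r2 Fhom Firr); rewrite form_rootsE hornerZ; apply/eqP.
by rewrite mulf_eq0 -/(root _ _) root_prod_XsubC mem_nth ?size_form_roots ?orbT.
Qed.

Lemma form_factor_thue : thue_form form_factor.
Proof.
split; first by exists f; exact: form_factor_prod.
by move=> i; split; [exact: cst_neq0|rewrite form_factor_root; exact: form_roots_algdeg].
Qed.

Lemma form_factor_value p :
  \prod_i lf (form_factor i) p = (F.@[pair_val p.1 p.2])%:~R.
Proof.
rewrite /lf (prod_linear_hom_ord (idfun : {rmorphism R[i] -> R[i]})) -form_factor_prod.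
rewrite /meval (mmap_dehomog _ _ _ Fhom) /hom [RHS]rmorph_sum.
by apply: eq_bigr => k _; rewrite coef_map !rmorphM !rmorphXn.
Qed.

(** A double root would give g^2 | g by [algdeg_dvdp_exp], for g = F(x, 1). *)
Lemma form_roots_inj (i j : 'I_r) : i != j -> alpha`_i != alpha`_j.
Proof.
move=> ij; apply/eqP => eij.
have sf := size_dehomog r2 Fhom Firr.
have fx : (map_poly intr f).[alpha`_i] = 0.
  rewrite form_rootsE hornerZ; apply/eqP.
  by rewrite mulf_eq0 -/(root _ _) root_prod_XsubC mem_nth ?size_form_roots ?orbT.
have sg : size (map_poly intr f : {poly rat}) = r.+1 by rewrite size_map_intr.
have xd : algdeg r (alpha`_i) by exact: form_roots_algdeg.
have := @algdeg_dvdp_exp _ r _ r2 xd (map_poly intr f)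
  (map_poly intr f) 2 sg.
rewrite map_poly_int_rat fx => /(_ erefl) H.
have /H : ('X - (alpha`_i)%:P) ^+ 2 %| map_poly intr f.
  rewrite form_rootsE dvdpZr ?a0_neq0 // (big_nth 0) size_form_roots big_mkord.
  by rewrite (bigD1 i) //= (bigD1 j) 1?eq_sym //= -eij mulrA -expr2 dvdp_mulr.
have f0 : (map_poly intr f : {poly rat}) != 0 by rewrite -size_poly_eq0 sg.
move/(dvdp_leq f0); rewrite sg; have := size_exp (map_poly intr f : {poly rat}) 2.
rewrite sg /=; move: (size _) => n; have := r3; clear; lia.
Qed.

(** Each linear factor occurs in r - 1 pairs, so the constants contribute a_0^(r-1) to the product
    of determinants, whichever factor carries a_0. Squaring gives the a_0^(2r-2) of the
    discriminant. *)
Lemma form_disc_factor :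
  ComplexField.Normc.normc (form_disc R r F) = disc1 form_factor ^+ 2.
Proof.
have ldetE i j : ldet (form_factor i) (form_factor j)
    = (cst i * cst j) * (alpha`_i - alpha`_j).
  by rewrite /ldet /form_factor -/(cst i) -/(cst j) /=; ring.
rewrite /form_disc -(dehomog_lead Fhom) -/a0 ncM ncX nc_prod /disc1.
under [in RHS]eq_bigr => i _ do (under eq_bigr => j _ do rewrite ldetE ncM ncM;
  rewrite big_split).
rewrite big_split /= exprMn; congr (_ * _).
  rewrite (@big_pairs_sym R 1 *%R r (fun i => nc (cst i))).
  under eq_bigr => i _ do rewrite prodr_const (eq_card (B := predC1 i)) ?cardC1
    ?card_ord //.
  rewrite prodrXl -nc_prod prod_cst -exprM; congr (_ ^+ _).
  by move: r3; clear; lia.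
rewrite -prodrXl; apply: eq_bigr => i _; rewrite nc_prod -prodrXl.
by apply: eq_bigr => j _; rewrite ncX.
Qed.

Lemma disc1_form_gt0 : 0 < disc1 form_factor.
Proof.
apply: prodr_gt0 => i _; apply: prodr_gt0 => j ij; rewrite nc_gt0.
have -> : ldet (form_factor i) (form_factor j)
    = (cst i * cst j) * (alpha`_i - alpha`_j).
  by rewrite /ldet /form_factor -/(cst i) -/(cst j) /=; ring.
rewrite !mulf_neq0 ?cst_neq0 // subr_eq0 form_roots_inj //.
by apply: contraTneq ij => ->; rewrite ltnn.
Qed.

End Translation.

(** * From lists to sets, comparison of the constants, and conclusion *)

Lemma finite_card_le (R : realType) (T : choiceType) (A : set T) (n : R) :
    (forall s : seq T, uniq s -> (forall x, x \in s -> A x) -> (size s)%:R <= n) ->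
  finite_set A /\ (#|` fset_set A|)%:R <= n.
Proof.
move=> h; have n0 : 0 <= n by apply: (h [::]).
have fA : finite_set A.
  apply: boolp.contrapT => /(infinite_set_fset (Num.trunc n).+1) [B BA sB].
  have := h (enum_fset B) (fset_uniq B) (fun x xB => BA x xB).
  apply/negP; rewrite -ltNge.
  have /andP [_ /lt_le_trans] := truncn_itv n0; apply.
  by rewrite ler_nat.
split=> //; apply: (h (enum_fset (fset_set A)) (fset_uniq _)) => x.
by rewrite in_fset_set // inE.
Qed.

Section Numerics.
Variable R : realType.

Lemma logstar_ge1 (x : R) : 1 <= logstar x.
Proof.
rewrite /logstar; case: (leP x (expR 1)) => [//|ex].
by rewrite -ler_expR lnK ?ltW // posrE (lt_trans (expR_gt0 1)).
Qed.

Lemma ln_le_logstar (x : R) : 0 < x -> ln x <= logstar x.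
Proof.
by move=> x0; rewrite /logstar; case: (leP x (expR 1)) => // xe; rewrite -ler_expR lnK.
Qed.

Lemma final_bound (r s : nat) (H l D y : R) :
    (3 <= r)%N -> 0 < H -> 1 <= l -> 0 < D -> 0 <= y ->
  (2 * H + 8 * (2 * (Bcst R * H) ^+ 2 / D)) * (30 * r%:R * (1 + l)) <=
  2 * (1 + l) * (3 + 4 * H + expR 105 * H ^+ 2 / D)
    * (1 + 8 * r%:R + 48 * s%:R * (15 + y)).
Proof.
move=> r3 H0 l1 D0 y0.
have rp : 0 <= r%:R :> R by exact: ler0n.
have l0 : 0 <= 1 + l by rewrite addr_ge0 // (le_trans _ l1).
set Z := H ^+ 2 / D; have Z0 : 0 <= Z by rewrite divr_ge0 ?sqr_ge0 // ltW.
have e1 : 2 <= expR 1 :> R by apply: le_trans (expR_ge1Dx 1);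
  rewrite -[X in X <= _]/(1 + 1).
(* 17280 = 8 * 2 * 6^2 * 30, with 6 from [Bcst], and 16 = 2 * 8 comes from the target. It remains
   that e^65 >= 2^65 exceeds 17280 / 16 = 1080. *)
have e105 : 17280 * expR 20 ^+ 2 <= 16 * expR 105 :> R.
  have -> : expR 105 = expR 20 ^+ 2 * expR 1 ^+ 65 :> R.
    by rewrite -!expRM_natl -expRD; congr expR; ring.
  have : 1080 <= expR 1 ^+ 65 :> R.
    apply: le_trans (_ : 2 ^+ 65 <= _); last by rewrite lerXn2r ?nnegrE ?expR_ge0.
    have -> : (65 = 11 + 54)%N by [].
    rewrite exprD; have : 1 <= (2 : R) ^+ 54 by rewrite exprn_ege1 // ler1n.
    have -> : (2 : R) ^+ 11 = 2048 by ring.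
    by move: (2 ^+ 54) => a; clear; lra.
  have : 0 <= expR 20 ^+ 2 :> R by rewrite sqr_ge0.
  move: (expR 20 ^+ 2) (expR 1 ^+ 65) => a b a0 b0.
  have := ler_wpM2l a0 b0; lra.
apply: le_trans (_ : 2 * (1 + l) * (3 + 4 * H + expR 105 * Z) * (8 * r%:R) <= _).
  have -> : 8 * (2 * (Bcst R * H) ^+ 2 / D) = 576 * (expR 20 ^+ 2 * Z).
    by rewrite /Z /Bcst; field; rewrite gt_eqF.
  have -> : (2 * H + 576 * (expR 20 ^+ 2 * Z)) * (30 * r%:R * (1 + l)) =
    (60 * H + 17280 * expR 20 ^+ 2 * Z) * (r%:R * (1 + l)) by ring.
  have -> : 2 * (1 + l) * (3 + 4 * H + expR 105 * Z) * (8 * r%:R) =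
    (48 + 64 * H + 16 * expR 105 * Z) * (r%:R * (1 + l)) by ring.
  rewrite ler_wpM2r ?mulr_ge0 //.
  have := ler_wpM2r Z0 e105; move: (_ * Z) (_ * Z) => a b; clear -H0; lra.
rewrite -[expR 105 * H ^+ 2 / D]mulrA -/Z ler_wpM2l //.
  have H4 : 0 <= 4 * H by rewrite mulr_ge0 // ltW.
  have eZ : 0 <= expR 105 * Z by rewrite mulr_ge0 ?expR_ge0.
  by rewrite mulr_ge0 ?addr_ge0 // mulr_ge0.
have : 0 <= 48 * s%:R * (15 + y) by rewrite !mulr_ge0 ?addr_ge0.
by move: (48 * _ * _) => a; lra.
Qed.

End Numerics.

Theorem theorem1p1 (R : realType) (r s : nat) (F : {mpoly int[2]}) (h : nat)
    (hr : (3 <= r)%N) (hs : (1 <= s)%N)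
    (F_homog : F \is r.-homog) (F_irr : irreducible_form F)
    (F_coef : (size (msupp F) <= s.+1)%N) (hh : (1 <= h)%N) :
  let h1r : R := h%:R `^ (1 / r%:R) in
  let h2r : R := h%:R `^ (2 / r%:R) in
  let D : R := ComplexField.Normc.normc (form_disc R r F) in
  finite_set (thue_solutions F h) /\
  (#|` fset_set (thue_solutions F h)|)%:R <=
    2 * (1 + logstar h1r)
      * (3 + 4 * h1r + expR 105 * h2r / D `^ (1 / (r%:R * (r%:R - 1))))
      * (1 + 8 * r%:R
         + 48 * s%:R * (15 + 1 / ln (r%:R - 1) * ln (logstar (2 * h1r)))).
Proof.
cbv zeta; set H : R := h%:R `^ (1 / r%:R); set D : R := ComplexField.Normc.normc _.
have r0 : r%:R != 0 :> R by rewrite pnatr_eq0; case: (r) hr.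
have h1 : 1 <= h%:R :> R by rewrite ler1n.
have h0 : 0 < h%:R :> R by apply: lt_le_trans h1.
have H0 : 0 < H by rewrite powR_gt0.
have Hh : H ^+ r = h%:R.
  by rewrite -powR_mulrn ?ltW // -powRrM div1r mulVf // powRr1 // ltW.
have -> : h%:R `^ (2 / r%:R) = H ^+ 2 :> R.
  by rewrite -powR_mulrn ?ltW // -powRrM div1r [_^-1 * _]mulrC.
have Lform := form_factor_thue R hr F_homog F_irr.
have d0 := disc1_form_gt0 R hr F_homog F_irr.
have DE : D = disc1 (form_factor R (r := r) F) ^+ 2 by exact: form_disc_factor.
set Delta : R := D `^ _.
have Delta0 : 0 < Delta by rewrite powR_gt0 // DE exprn_gt0.
have DeltaE : Delta ^+ npairs r = disc1 (form_factor R (r := r) F).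
  have np : (npairs r)%:R = r%:R * (r%:R - 1) / 2 :> R.
    have rp : r.-1%:R = r%:R - 1 :> R by rewrite -subn1 natrB //; case: (r) hr.
    by rewrite -rp -natrM -npairsE natrM mulfK // pnatr_eq0.
  rewrite -powR_mulrn ?(ltW Delta0) // -powRrM np.
  have -> : 1 / (r%:R * (r%:R - 1)) * (r%:R * (r%:R - 1) / 2) = 2^-1 :> R.
    have r1 : r%:R - 1 != 0 :> R.
      by rewrite subr_eq0 pnatr_eq1; case: (r) hr => [|[|]].
    by field; rewrite r0 r1.
  by rewrite powR12_sqrt ?DE ?sqr_ge0 // sqrtr_sqr gtr0_norm.
apply: finite_card_le => t ut ht.
have l1 := logstar_ge1 H.
have hl : ln h%:R <= r%:R * logstar H.
  by rewrite -Hh lnXn // -[_ *+ r]mulr_natl ler_wpM2l // ln_le_logstar.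
have := solution_count hr Lform h1 H0 Hh l1 hl Delta0 DeltaE ut.
move=> /(_ _)/le_trans; apply.
  move=> p /ht [p0 pF]; split=> //.
  by rewrite (form_factor_value R hr F_homog F_irr) nc_int -[h%:R]/((Posz h)%:~R) ler_int.
apply: final_bound => //.
have r2 : 1 <= r%:R - 1 :> R.
  by rewrite lerBrDr -(natrD R 1 1) ler_nat ltnW.
by rewrite mulr_ge0 ?divr_ge0 // ln_ge0 // logstar_ge1.
Qed.
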